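(* The infinity testing problem for unary automatic graphs of finite degree is solvable in time $O(p^3)$: there is an algorithm which, given a (standard one-loop) automaton $\mathcal{A}$ with loop constant $p$ recognizing the edge relation of a unary automatic graph of finite degree $\mathcal{G}$, and a vertex $v$ of $\mathcal{G}$, decides in time $O(p^3)$ whether the component of $\mathcal{G}$ containing $v$ is infinite. In particular, when $\mathcal{A}$ is fixed, there is a constant time algorithm that decides the infinity testing problem on $\mathcal{G}$.
   Context: Let $\diamond$ be a symbol different from $1$. The convolution $\otimes(1^m,1^n)$ is the word of length $\max(m,n)$ over $\{1,\diamond\}^2$ whose $k$-th letter is $(a,b)$, where $a=1$ if $k\le m$ and $a=\diamond$ otherwise, and $b=1$ if $k\le n$ and $b=\diamond$ otherwise. An automaton (always a deterministic finite automaton) recognizes a binary relation $E\subseteq 1^\star\times 1^\star$ if it accepts exactly the convolutions of the pairs in $E$. A unary automatic graph is a graph $\mathcal{G}=(V,E)$ with $V=1^\star$ and $E$ recognized by some automaton. Graphs are undirected ($E$ is symmetric). A graph is of finite degree if there are only finitely many edges from each vertex. A component is a connected component. In an automaton recognizing a binary relation over $1^\star$, the $(1,1)$-states are the states reachable from the initial state by reading letters $(1,1)$; they form a disjoint union of a tail (a sequence of states linked by transitions without repetition) and a loop (a cycle), called the $(1,1)$-tail and $(1,1)$-loop. For a $(1,1)$-state $s$, the states reachable from $s$ by reading letters $(1,\diamond)$ (resp. $(\diamond,1)$) likewise form $(1,\diamond)$-tails and loops (resp. $(\diamond,1)$-tails and loops). A one-loop automaton is one whose transition diagram contains exactly one loop,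 the $(1,1)$-loop. It is standard with loop constant $p$ if its loop and all its tails have length $p$; thus it has $p$ states on the $(1,1)$-tail, $p$ states on the $(1,1)$-loop, and from each of these $2p$ states a $(1,\diamond)$-tail and a $(\diamond,1)$-tail of length $p$. A unary automatic graph of finite degree is always given by a standard one-loop automaton recognizing its edge relation. The vertices of $\mathcal{G}$ are grouped into consecutive blocks of $p$ vertices, and an input vertex is given as a pair $(x,i)$ consisting of its position $x\in\{0,\dots,p-1\}$ within its block and the index $i$ of the block (so the bound does not depend on $i$). The infinity testing problem: given such an automaton for $\mathcal{G}$ and a vertex $v$, decide whether the component of $\mathcal{G}$ containing $v$ is infinite. *)

(* Defs.v *)
From HB Require Import structures.
From Stdlib Require Import Relation_Definitions Relation_Operators.
From mathcomp Require Import all_boot.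
From mathcomp Require Import classical_sets functions cardinality.

Set Implicit Arguments.
Unset Strict Implicit.
Unset Printing Implicit Defensive.

Local Open Scope nat_scope.

(* A letter of {1,<>}^2 is a pair of booleans, [true] standing for the symbol 1
   and [false] for the padding symbol; the word 1^m is represented by m. *)
Definition letter : Type := (bool * bool)%type.
Definition L11 : letter := (true, true).
Definition L1d : letter := (true, false).
Definition Ld1 : letter := (false, true).
Definition Ldd : letter := (false, false).

Definition convolution (m n : nat) : seq letter :=
  [seq (k < m, k < n) | k <- iota 0 (maxn m n)].

(* The transition function is partial: a total automaton would need a sink,
   whose self-loops would prevent it from having a single loop. *)
Record dfa := Dfa {
  nstates : nat;
  init : 'I_nstates;
  delta : 'I_nstates -> letter -> option 'I_nstates;
  final : pred 'I_nstates
}.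

Fixpoint run (A : dfa) (q : 'I_(nstates A)) (w : seq letter) :
    option 'I_(nstates A) :=
  if w is a :: w' then
    if delta q a is Some r then run r w' else None
  else Some q.

Definition accepts (A : dfa) (w : seq letter) : bool :=
  if run (init A) w is Some q then final q else false.

Definition recognizes (A : dfa) (E : relation nat) : Prop :=
  forall w, accepts A w <-> exists m n, w = convolution m n /\ E m n.

Definition linked (A : dfa) (a : letter) : rel 'I_(nstates A) :=
  fun q r => delta q a == Some r.

(* A loop of the transition diagram is given by its transitions, each one being
   a source state together with the letter read there. *)
Definition is_loop (A : dfa) (c : seq ('I_(nstates A) * letter)) : bool :=
  [&& c != [::],
      cycle (fun t u => delta t.1 t.2 == Some u.1) c
    & uniq (unzip1 c)].

Definition one_one_state (A : dfa) (q : 'I_(nstates A)) : Prop :=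
  exists k, run (init A) (nseq k L11) = Some q.

(* The transition diagram contains exactly one loop (up to the choice of its
   starting point), namely c, and c is the (1,1)-loop. *)
Definition one_loop (A : dfa) (c : seq ('I_(nstates A) * letter)) : Prop :=
  [/\ is_loop c,
      forall c', is_loop c' -> exists k, c' = rot k c
    & forall t, t \in c -> one_one_state t.1 /\ t.2 = L11].

(* The states met when reading the letter a from s, s excluded, form a tail of
   length p that is not followed by a loop. *)
Definition has_tail (A : dfa) (a : letter) (p : nat) (s : 'I_(nstates A)) :
    Prop :=
  exists t : seq 'I_(nstates A),
    [/\ size t = p, path (linked a) s t, uniq (s :: t)
      & delta (last s t) a = None].

(* t is the (1,1)-tail, which starts with the initial state, and c is the
   (1,1)-loop, listed from the state where the tail enters it. *)
Definition standard (A : dfa) (p : nat) : Prop :=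
  exists (t : seq 'I_(nstates A)) (c : seq ('I_(nstates A) * letter)),
    let s := t ++ unzip1 c in
    [/\ one_loop c,
        size t = p /\ size c = p,
        [/\ ohead s = Some (init A), sorted (linked L11) s & uniq s]
      & forall q, q \in s -> has_tail L1d p q /\ has_tail Ld1 p q].

Definition finite_degree (E : relation nat) : Prop :=
  forall v, finite_set [set u | E v u].

Definition component (E : relation nat) (v : nat) : set nat :=
  [set u | clos_refl_trans nat E v u].

(* E is the edge relation of a unary automatic graph of finite degree that is
   given by the standard one-loop automaton A with loop constant p. *)
Definition presents (A : dfa) (p : nat) (E : relation nat) : Prop :=
  [/\ standard A p, recognizes A E, Relation_Definitions.symmetric nat E
    & finite_degree E].

(* The position x in the block of index i, for blocks of p vertices. *)
Definition vertex (p x i : nat) : nat := i * p + x.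

(* Algorithms are programs of the random access machine of Cook and Reckhow,
   with unit cost per instruction, over natural numbers (so that subtraction is
   truncated).  There is no multiplication.  The input is a read-only sequence
   of numbers, accessible by index (0 past its end); all registers initially hold 0.  Addresses
   of registers are numbers; [ILoad] and [IStore] are the indirect accesses. *)
Inductive instr :=
| IConst of nat & nat          (* IConst r n : R[r] := n *)
| IAdd of nat & nat & nat      (* IAdd r a b : R[r] := R[a] + R[b] *)
| ISub of nat & nat & nat      (* ISub r a b : R[r] := R[a] - R[b] *)
| ILoad of nat & nat           (* ILoad r a  : R[r] := R[R[a]] *)
| IStore of nat & nat          (* IStore a r : R[R[a]] := R[r] *)
| IRead of nat & nat           (* IRead r a  : R[r] := input[R[a]] *)
| IJpos of nat & nat.          (* IJpos r l  : go to l if R[r] > 0 *)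

Definition program := seq instr.

Record config := Config { pc : nat; reg : nat -> nat }.

Definition upd (m : nat -> nat) (r v : nat) : nat -> nat :=
  fun j => if j == r then v else m j.

Definition exec (inp : seq nat) (ins : instr) (c : config) : config :=
  let m := reg c in
  let next := (pc c).+1 in
  match ins with
  | IConst r n => Config next (upd m r n)
  | IAdd r a b => Config next (upd m r (m a + m b))
  | ISub r a b => Config next (upd m r (m a - m b))
  | ILoad r a  => Config next (upd m r (m (m a)))
  | IStore a r => Config next (upd m (m a) (m r))
  | IRead r a  => Config next (upd m r (nth 0 inp (m a)))
  | IJpos r l  => Config (if 0 < m r then l else next) m
  end.

Definition start : config := Config 0 (fun=> 0).

Definition halted (P : program) (c : config) : bool := size P <= pc c.

Definition step (P : program) (inp : seq nat) (c : config) : config :=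
  if onth P (pc c) is Some ins then exec inp ins c else c.

(* The answer is the final content of register 0: 1 for yes and 0 for no. *)
Definition decides_within (P : program) (inp : seq nat) (T : nat) (Q : Prop) :
    Prop :=
  exists (k : nat) (b : bool),
    let c := iter k (step P inp) start in
    [/\ k <= T, halted P c, reg c 0 = b & b <-> Q].

(* An undefined transition is encoded by 0, a transition to q by q + 1. *)
Definition encode_target (n : nat) (o : option 'I_n) : nat :=
  if o is Some q then (val q).+1 else 0.

Definition encode_state (A : dfa) (q : 'I_(nstates A)) : seq nat :=
  [:: nat_of_bool (final q);
      encode_target (delta q L11); encode_target (delta q L1d);
      encode_target (delta q Ld1); encode_target (delta q Ldd)].

Definition encode_dfa (A : dfa) : seq nat :=
  [:: nstates A; val (init A)] ++
  flatten [seq encode_state q | q <- enum 'I_(nstates A)].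

(* Main.v *)
(* Write E(v, v + d) for the edges of the graph: they satisfy d <= p and, beyond
   the first block, are invariant under translation by p.  If a path climbs (or
   descends) through p + 1 consecutive levels i >= 1, i.e. blocks of p vertices,
   then by pigeonhole it meets two of them at the same position, and the part
   between, cut so as to stay above the lower level, can be translated upwards
   for ever.  Hence the component of a vertex of one of the blocks 0, ..., p + 1
   is infinite if and only if it contains a vertex of index at least
   N = (2p + 1)p, and for i > p the answer for (x, i) is the answer for
   (x, p + 1), since whichever way an infinite component leaves the p blocks
   around i, a pump is found within blocks >= 1.  A breadth-first search of the
   first N vertices, each having at most 2p + 1 neighbours, therefore decides
   the problem in O(p^3) steps.  For a fixed automaton the p(p + 2) answers for
   (x, min(i, p + 1)) are compiled into the program. *)
Require Import Defs.
From Stdlib Require Import Relation_Definitions Relation_Operators.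
From Stdlib Require Import Operators_Properties.
From mathcomp Require Import all_boot.
From mathcomp Require Import zify.
From mathcomp Require Import boolp classical_sets functions cardinality.

Local Open Scope nat_scope.

Set Implicit Arguments.
Unset Strict Implicit.
Unset Printing Implicit Defensive.

(** * Unbounded sets of numbers and reflexive-transitive closures *)

Lemma infinite_set_unbounded (A : set nat) :
  infinite_set A <-> forall N, exists u, A u /\ N <= u.
Proof.
split=> [infA N | unbA /finite_seqP [s As]].
  have [//|noA] := pselect (exists u, A u /\ N <= u).
  case: infA; apply: sub_finite_set (finite_II N) => u Au /=.
  by rewrite ltnNge; apply/negP => leNu; apply: noA; exists u.
have [u []] := unbA (\max_(x <- s) x).+1.
rewrite As /= => us; rewrite ltnNge => /negP; apply.
exact: (leq_bigmax_seq u).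
Qed.

Lemma clos_rt_sym T (R : relation T) x y :
  Relation_Definitions.symmetric T R -> clos_refl_trans T R x y ->
  clos_refl_trans T R y x.
Proof.
move=> symR; elim=> {x y} [x y xy|x|x y z _ yx _ zy].
- by apply: rt_step; apply: symR.
- exact: rt_refl.
- exact: rt_trans zy yx.
Qed.

Lemma clos_rt_map T S (f : T -> S) (R : relation T) (R' : relation S) x y :
  (forall x y, R x y -> R' (f x) (f y)) ->
  clos_refl_trans T R x y -> clos_refl_trans S R' (f x) (f y).
Proof.
move=> RR'; elim=> {x y} [x y xy|x|x y z _ xy _ yz].
- by apply: rt_step; apply: RR'.
- exact: rt_refl.
- exact: rt_trans xy yz.
Qed.

(** * Periodic graphs *)

Section PeriodicGraph.

Variables (E : relation nat) (p : nat).
Hypothesis p_gt0 : 0 < p.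
Hypothesis symE : Relation_Definitions.symmetric nat E.
Hypothesis shortE : forall v u, E v u -> u <= v + p.
Hypothesis shiftE : forall v u, p <= v -> p <= u -> E v u <-> E (v + p) (u + p).

(** Only paths that stay above the first block can be translated by p, hence the lower bound [lo] on
    all vertices of the path. *)
Definition conn_above (lo : nat) : relation nat :=
  clos_refl_trans nat (fun v u => [/\ E v u, lo <= v & lo <= u]).

Lemma conn_above_sym lo v u : conn_above lo v u -> conn_above lo u v.
Proof. by apply: clos_rt_sym => a b [ab ha hb]; split=> //; apply: symE. Qed.

Lemma conn_above_ge lo v u : lo <= v -> conn_above lo v u -> lo <= u.
Proof. by move=> lov vu; elim: vu lov => [? ? []||? ? ? _ ab _ bc /ab /bc]. Qed.

Lemma conn_above_le lo lo' v u :
  lo' <= lo -> conn_above lo v u -> conn_above lo' v u.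
Proof.
move=> le_lo; apply: (clos_rt_map (f := id)) => a b [ab ha hb].
by split=> //; apply: leq_trans le_lo _.
Qed.

Lemma conn_above_component lo v u : conn_above lo v u -> component E v u.
Proof. by apply: (clos_rt_map (f := id)) => a b []. Qed.

Lemma conn_above_shift lo v u :
  p <= lo -> conn_above lo v u -> conn_above (lo + p) (v + p) (u + p).
Proof.
move=> ple; apply: (clos_rt_map (f := addn^~ p)) => a b [ab ha hb].
split; [|by rewrite leq_add2r..].
by apply/(shiftE _ _).1 => //; apply: leq_trans ple _.
Qed.

(** Truncation is harmless: every edge of the path has both ends at least [lo + p]. *)
Lemma conn_above_unshift lo v u :
  p <= lo -> conn_above (lo + p) v u -> conn_above lo (v - p) (u - p).
Proof.
move=> ple; apply: (clos_rt_map (f := subn^~ p)) => a b [ab ha hb].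
split; [|lia..].
by apply/shiftE; [lia..|rewrite !subnK //; lia].
Qed.

(** The translates of the path from y to [y + k * p] by multiples of [k * p] concatenate into paths
    to arbitrarily high vertices, none of which falls below [lo]. *)
Lemma pump_infinite lo y k :
  p <= lo -> 0 < k -> conn_above lo y (y + k * p) ->
  infinite_set [set u | conn_above lo y u].
Proof.
move=> ple k_gt0 conn_y; apply/infinite_set_unbounded => N.
exists (y + N * (k * p)); split; last first.
  by apply: leq_trans (leq_addl y _); rewrite leq_pmulr // muln_gt0 k_gt0.
have shift_k l a b j : p <= l -> conn_above l a b ->
    conn_above (l + j * p) (a + j * p) (b + j * p).
  move=> pl ab; elim: j => [|j IHj]; first by rewrite mul0n !addn0.
  rewrite mulSnr !addnA; apply: conn_above_shift => //; lia.
elim: N => [|N IHN]; first by rewrite mul0n addn0; apply: rt_refl.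
apply: rt_trans IHN _; have := @shift_k _ _ _ (N * k) ple conn_y.
move/(@conn_above_le _ lo); rewrite leq_addr => /(_ isT).
by rewrite mulSn -addnA -mulnA [k * p + _]addnC.
Qed.

(** Follow the path from w until it first drops below level j: as edges have length at most p, the
    vertex just before the drop lies in block j. *)
Lemma conn_above_or_level w u j :
  j * p <= w -> component E w u ->
  conn_above (j * p) w u \/
  exists y, j * p <= y < j.+1 * p /\ conn_above (j * p) w y.
Proof.
move=> jw wu; elim: (clos_rt_rtn1 _ _ _ _ wu) => {u wu} [|b c bc _ [wb|]].
- by left; apply: rt_refl.
- have jb : j * p <= b by apply: conn_above_ge wb.
  have [jc|cj] := leqP (j * p) c.
    by left; apply: rt_trans wb _; apply: rt_step.
  right; exists b; split=> //; rewrite jb /= mulSnr.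
  by apply: leq_ltn_trans (shortE (symE bc)) _; rewrite ltn_add2r.
- by right.
Qed.

(** Pigeonhole: there are p + 1 levels but only p residues modulo p, so two of the vertices found
    differ by a positive multiple of p, and [pump_infinite] applies. *)
Lemma levels_infinite w l :
  0 < l ->
  (forall j, l <= j <= l + p ->
     exists y, j * p <= y < j.+1 * p /\ conn_above (j * p) w y) ->
  infinite_set [set u | conn_above (l * p) w u].
Proof.
move=> l_gt0 lev.
have levI (j : 'I_p.+1) : exists y,
    (l + j) * p <= y < (l + j).+1 * p /\ conn_above ((l + j) * p) w y.
  by apply: lev; rewrite leq_addr leq_add2l -ltnS ltn_ord.
have [y yP] := choice levI.
pose f (j : 'I_p.+1) : 'I_p := Ordinal (ltn_pmod (y j) p_gt0).
have /injectivePn [j1 [j2 nej fE]] : ~~ injectiveb f.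
  by apply/injectiveP => /leq_card; rewrite !card_ord ltnn.
have {fE} modE : y j1 = y j2 %[mod p] by case: fE.
have yE j : y j = (l + j) * p + y j %% p.
  have [/andP[lo hi] _] := yP j; rewrite [LHS](divn_eq _ p); congr (_ * _ + _).
  by apply/eqP; rewrite eqn_leq -ltnS ltn_divLR // leq_divRL // hi lo.
wlog lt12 : j1 j2 nej modE / j1 < j2.
  move=> H; have := nej; rewrite -(inj_eq val_inj) /= neq_ltn.
  case/orP=> lt; first exact: (H j1 j2).
  by apply: (H j2 j1) => //; rewrite eq_sym.
have [_ c1] := yP j1; have [_ c2] := yP j2.
(* The two vertices are joined through w, and both halves stay above the lower of the two levels. *)
have yy : conn_above ((l + j1) * p) (y j1) (y j1 + (j2 - j1) * p).
  have -> : y j1 + (j2 - j1) * p = y j2.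
    by rewrite (yE j1) (yE j2) modE; nia.
  apply: rt_trans (conn_above_sym c1) _.
  by apply: conn_above_le c2; rewrite leq_mul2r leq_add2l ltnW ?orbT.
have /infinite_set_unbounded inf_y :
    infinite_set [set u | conn_above ((l + j1) * p) (y j1) u].
  by apply: pump_infinite yy; [nia|lia].
apply/infinite_set_unbounded => N; have [u [cu Nu]] := inf_y N.
exists u; split=> //=; apply: (@conn_above_le ((l + j1) * p)); first by nia.
exact: rt_trans c1 cu.
Qed.

Lemma infinite_component_conn v w :
  component E v w -> infinite_set (component E w) -> infinite_set (component E v).
Proof.
move=> vw /infinite_set_unbounded inf; apply/infinite_set_unbounded => N.
have [u [wu Nu]] := inf N; exists u; split=> //; exact: rt_trans vw wu.
Qed.

Lemma infinite_component_above lo v :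
  infinite_set [set u | conn_above lo v u] -> infinite_set (component E v).
Proof.
move/infinite_set_unbounded => inf; apply/infinite_set_unbounded => N.
have [u [vu Nu]] := inf N; exists u; split=> //; exact: conn_above_component vu.
Qed.

(** A path from a vertex [w] at or above N back to v, which lies in one of the blocks 0, ..., p + 1,
    meets all the levels p + 1, ..., 2p + 1, enough for [levels_infinite]. *)
Lemma infinite_componentP v :
  v < p.+2 * p ->
  infinite_set (component E v) <->
  exists u, component E v u /\ p.*2.+1 * p <= u.
Proof.
move=> v_lt; split=> [/infinite_set_unbounded //|[w [vw w_ge]]].
apply: (infinite_component_conn vw); apply: (@infinite_component_above (p.+1 * p)).
apply: levels_infinite => // j /andP[lo hi].
have jw : j * p <= w by apply: leq_trans w_ge; rewrite leq_mul2r; lia.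
have [wv|//] := conn_above_or_level jw (clos_rt_sym symE vw).
(* A path that never drops below level j ends at v, which is then itself in block j, being below
   block p + 2. *)
exists v; split=> //; rewrite (conn_above_ge jw wv) /=.
by apply: leq_trans v_lt _; rewrite leq_mul2r; lia.
Qed.

(** Either the whole component is reached from v above level l, and nothing is lost, or some path
    leaves downwards through the levels l + p, ..., l, which already makes the upper part
    infinite. *)
Lemma infinite_component_aboveP l v :
  0 < l -> (l + p) * p <= v ->
  infinite_set (component E v) <-> infinite_set [set u | conn_above (l * p) v u].
Proof.
move=> l_gt0 lv; split; last exact: infinite_component_above.
have [sub inf|] := pselect (component E v `<=` [set u | conn_above (l * p) v u])%classic.
  by move=> fin; apply: inf; apply: sub_finite_set fin.
move=> /existsNP [u /not_implyP [vu nvu]] _.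
apply: levels_infinite => // j /andP[lo hi].
have jv : j * p <= v by apply: leq_trans lv; rewrite leq_mul2r hi orbT.
have [cvu|//] := conn_above_or_level jv vu.
by case: nvu; apply: conn_above_le cvu; rewrite leq_mul2r lo orbT.
Qed.

(** Restrict to paths from block 1 on for v and from block 2 on for [v + p]: the two reachable sets
    are translates of each other, and v is high enough for both restrictions to preserve
    infinity. *)
Lemma infinite_component_shift v :
  p.+1 * p <= v ->
  infinite_set (component E v) <-> infinite_set (component E (v + p)).
Proof.
move=> v_ge.
rewrite (@infinite_component_aboveP 1 v) ?add1n //.
rewrite (@infinite_component_aboveP 2 (v + p)) ?add2n //; last by nia.
rewrite !infinite_set_unbounded mul1n mul2n -addnn; split=> inf N.
  have [u [vu Nu]] := inf N; exists (u + p); split; last by lia.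
  exact: conn_above_shift vu.
have [u [vu Nu]] := inf (N + p); exists (u - p); split; last by lia.
by have /= := conn_above_unshift (leqnn p) vu; rewrite addnK.
Qed.

Lemma infinite_component_minn x i :
  infinite_set (component E (vertex p x i)) <->
  infinite_set (component E (vertex p x (minn i p.+1))).
Proof.
have [le_i|/ltnW/subnK <-] := leqP i p.+1; first by [].
elim: (i - _) => // k <-; rewrite addSn /vertex mulSnr addnAC.
by apply: iff_sym; apply: infinite_component_shift; nia.
Qed.

End PeriodicGraph.

(** * The edges read off a standard automaton *)

Lemma count_ltn_iota m n : count (fun k => k < m) (iota 0 n) = minn m n.
Proof.
elim: n => [|n IHn]; first by rewrite minn0.
by rewrite -addn1 iotaD count_cat IHn /= add0n addn0; lia.
Qed.

(** Each length is recovered by counting the letters whose corresponding coordinate is the symbol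
    1. *)
Lemma convolution_inj m n m' n' :
  convolution m n = convolution m' n' -> m = m' /\ n = n'.
Proof.
move=> eq_conv; split.
  have := congr1 (count fst) eq_conv.
  rewrite !count_map (eq_count (a2 := fun k => k < m)) //.
  by rewrite [RHS](eq_count (a2 := fun k => k < m')) // !count_ltn_iota; lia.
have := congr1 (count snd) eq_conv.
rewrite !count_map (eq_count (a2 := fun k => k < n)) //.
by rewrite [RHS](eq_count (a2 := fun k => k < n')) // !count_ltn_iota; lia.
Qed.

Lemma map_in_const (T S : eqType) (f : T -> S) (s : seq T) y :
  {in s, forall x, f x = y} -> map f s = nseq (size s) y.
Proof.
move=> fy; rewrite -(size_map f); apply/all_pred1P/allP => _ /mapP[x xs ->].
by rewrite /= fy.
Qed.

Lemma convolution_split v d : convolution v (v + d) = nseq v L11 ++ nseq d Ld1.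
Proof.
rewrite /convolution (_ : maxn _ _ = v + d); last by lia.
rewrite iotaD map_cat add0n; congr (_ ++ _).
  rewrite -[in RHS](size_iota 0 v); apply: map_in_const => k.
  by rewrite mem_iota add0n => /andP[_ kv]; rewrite kv ltn_addr.
rewrite -[in RHS](size_iota v d); apply: map_in_const => k.
by rewrite mem_iota => /andP[vk kd]; rewrite kd ltnNge vk.
Qed.

Lemma run_cat A q w w' :
  run (A := A) q (w ++ w') = obind (fun r => run r w') (run q w).
Proof. by elim: w q => //= a w IHw q; case: (delta q a). Qed.

Lemma run_rcons A q w a :
  run (A := A) q (rcons w a) = obind (fun r => delta r a) (run q w).
Proof. by rewrite -cats1 run_cat; case: (run q w) => //= r; case: delta. Qed.

Lemma nseq_rcons T n (x : T) : nseq n.+1 x = rcons (nseq n x) x.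
Proof. by elim: n => //= n <-. Qed.

(** The exact length serves twice: it bounds the length of the edges, and it lets the program
    recover p, which is not part of its input. *)
Lemma run_tail A a p (s : 'I_(nstates A)) : has_tail a p s ->
  (forall d, d <= p -> run s (nseq d a) != None) /\ run s (nseq p.+1 a) = None.
Proof.
case=> t [<- {p} + _ +]; elim: t s => [|q t IHt] s /=.
  by move=> _ ->; split=> // -[].
move=> /andP[/eqP sq qt] last_t; have [def_run undef_run] := IHt q qt last_t.
by split=> [[|d] //|]; rewrite /= sq //; apply: def_run.
Qed.

Lemma linked_one_one_run A p (s : seq 'I_(nstates A)) :
  0 < p -> size s = p + p -> ohead s = Some (init A) -> sorted (linked L11) s ->
  cycle (linked L11) (drop p s) ->
  exists st : nat -> 'I_(nstates A),
    [/\ forall v, run (init A) (nseq v L11) = Some (st v),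
        forall v, st v \in s & forall v, p <= v -> st (v + p) = st v].
Proof.
move=> p_gt0 sz_s hd_s sort_s cyc_s.
(* Index in [s] of the state met after v letters: the tail occupies the first p places, the loop the
   next p. *)
pose ix v := if v < p then v else p + (v - p) %% p.
have ix_lt v : ix v < size s.
  by rewrite /ix sz_s; case: (ltnP v p) => ?; [lia|rewrite ltn_add2l ltn_pmod].
pose st v := nth (init A) s (ix v).
exists st; split=> [||v pv].
- elim=> [|v IHv]; first by rewrite /st /ix p_gt0 /=; case: (s) hd_s => //= ? ? [->].
  rewrite nseq_rcons run_rcons IHv /=; apply/eqP; rewrite /st.
  have step_s k : k.+1 < size s ->
      linked L11 (nth (init A) s k) (nth (init A) s k.+1).
    by move=> kP; apply/(sortedP _ sort_s).
  have [ix_lt2|ix_ge2] := ltnP (ix v).+1 (size s).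
    have -> : ix v.+1 = (ix v).+1; last exact: step_s.
    move: ix_lt2; rewrite sz_s /ix; have [vp|pv] := ltnP v p.
      by move=> _; case: (ltnP v.+1 p) => // pv1; rewrite (_ : v.+1 - p = 0) ?mod0n; lia.
    case: (ltnP v.+1 p) => [|_ lt2]; first by lia.
    rewrite subSn // -addn1 -modnDml modn_small; lia.
  (* From the last index of [s] the closing transition of the loop leads back to index p. *)
  have ix_eq : ix v = (p + p).-1 by have := ix_lt v; lia.
  have [vp|pv] := ltnP v p; first by move: ix_eq; rewrite /ix vp; lia.
  have -> : ix v.+1 = p.
    move: ix_eq; rewrite /ix; case: (ltnP v p) => [|_ ixE]; first by lia.
    case: (ltnP v.+1 p) => [|_]; first by lia.
    rewrite subSn // -addn1 -modnDml (_ : (v - p) %% p = p.-1); last by lia.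
    by rewrite addn1 prednK // modnn addn0.
  rewrite ix_eq; case def_c: (drop p s) cyc_s => [|q c].
    by move/(congr1 size): def_c; rewrite size_drop sz_s /=; lia.
  rewrite /= rcons_path => /andP[_].
  have -> : last q c = nth (init A) s (p + p).-1.
    rewrite (last_nth (init A)) -def_c nth_drop; congr (nth _ _ _).
    by move/(congr1 size): def_c; rewrite size_drop sz_s /=; lia.
  by rewrite (_ : q = nth (init A) s p) // -[p]addn0 -nth_drop def_c.
- by move=> v; apply: mem_nth.
- rewrite /st /ix; case: (ltnP v p) => [|_]; first by lia.
  by case: (ltnP (v + p) p) => [|_]; [lia|rewrite [v + p]addnC -addnBA // modnDl].
Qed.

(** By symmetry an edge is described by its lower end v and its length d; this is the convolution of
    v and v + d. *)
Definition edge A v d := accepts A (nseq v L11 ++ nseq d Ld1).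

Lemma edgeP A E v d : recognizes A E -> E v (v + d) <-> edge A v d.
Proof.
move=> recA; rewrite /edge; split=> [vd | /recA [m [n [eq_conv Emn]]]].
  by apply/recA; exists v, (v + d); rewrite convolution_split.
by rewrite -convolution_split in eq_conv; have [-> ->] := convolution_inj eq_conv.
Qed.

(** After v letters (1,1) the run is in a state whose (<>,1)-tail has length exactly p; from v = p
    on, this state has period p in v. *)
Lemma standard_runs A p : 0 < p -> standard A p ->
  [/\ forall v d, d <= p -> run (init A) (nseq v L11 ++ nseq d Ld1) != None,
      forall v, run (init A) (nseq v L11 ++ nseq p.+1 Ld1) = None
    & forall v d, p <= v -> edge A (v + p) d = edge A v d].
Proof.
move=> p_gt0 [t [c [[loop_c _ L11c] [sz_t sz_c] [hd_s sort_s _] tails]]].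
(* All transitions of the loop read (1,1), so the loop is a cycle for [linked L11]. *)
have cyc_c : cycle (linked L11) (drop p (t ++ unzip1 c)).
  rewrite drop_size_cat // cycle_map; case/and3P: loop_c => _ cyc _.
  apply: (sub_in_cycle (P := mem c)) cyc; last exact/allP.
  by move=> a b /= /L11c [_ a2] _; rewrite /linked /= a2.
have [|st [st_run st_s st_p]] := linked_one_one_run p_gt0 _ hd_s sort_s cyc_c.
  by rewrite size_cat size_map sz_t sz_c.
split=> [v d dp|v|v d pv].
- rewrite run_cat st_run /=; have [_ /run_tail [def_run _]] := tails _ (st_s v).
  exact: def_run.
- by rewrite run_cat st_run /=; have [_ /run_tail []] := tails _ (st_s v).
- by rewrite /edge /accepts !run_cat !st_run /= st_p.
Qed.

Lemma edge_le A p v d : 0 < p -> standard A p -> edge A v d -> d <= p.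
Proof.
move=> p_gt0 stdA; apply: contraTT; rewrite -ltnNge => pd.
have [_ undef_run _] := standard_runs p_gt0 stdA.
by rewrite /edge /accepts -(subnKC pd) nseqD catA run_cat undef_run.
Qed.

Definition joined (e : nat -> nat -> bool) v u :=
  if v <= u then e v (u - v) else e u (v - u).

Lemma joined_edgeP A E v u : recognizes A E -> Relation_Definitions.symmetric nat E ->
  E v u <-> joined (edge A) v u.
Proof.
move=> recA symE; rewrite /joined; have [vu|/ltnW uv] := leqP v u.
  by rewrite -(edgeP _ _ recA) subnKC.
by rewrite -(edgeP _ _ recA) subnKC //; split=> /symE.
Qed.

Lemma presents_short A p E v u : 0 < p -> presents A p E -> E v u -> u <= v + p.
Proof.
move=> p_gt0 [stdA recA symE _] /(joined_edgeP _ _ recA symE); rewrite /joined.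
by have [vu /(edge_le p_gt0 stdA)|] := leqP v u; lia.
Qed.

Lemma presents_shift A p E v u : 0 < p -> presents A p E ->
  p <= v -> p <= u -> E v u <-> E (v + p) (u + p).
Proof.
move=> p_gt0 [stdA recA symE _] pv pu; rewrite !(joined_edgeP _ _ recA symE) /joined.
have [_ _ edge_p] := standard_runs p_gt0 stdA.
by rewrite leq_add2r !subnDr; case: ifP => _; rewrite edge_p.
Qed.

Lemma nth_flatten_uniform T (x0 : T) n (ss : seq (seq T)) k j :
  all (fun s => size s == n) ss -> j < n -> k < size ss ->
  nth x0 (flatten ss) (k * n + j) = nth x0 (nth [::] ss k) j.
Proof.
move=> + jn; elim: ss k => [|s ss IHs] [|k] //= /andP[/eqP sz_s all_ss] kP.
  by rewrite nth_cat sz_s jn.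
by rewrite nth_cat sz_s mulSn -addnA ltnNge leq_addr /= addKn IHs.
Qed.

(** The offset 4 skips x, i, the number of states and the initial state; each state then takes 5
    entries. *)
Lemma nth_encode_dfa (A : dfa) x i (q : 'I_(nstates A)) j : j < 5 ->
  nth 0 ([:: x; i] ++ encode_dfa A) (4 + (q * 5 + j)) = nth 0 (encode_state q) j.
Proof.
move=> j5; rewrite /encode_dfa /= nth_flatten_uniform //.
- by rewrite (nth_map q) ?size_enum_ord // nth_ord_enum.
- by apply/allP => _ /mapP[r _ ->].
- by rewrite size_map size_enum_ord.
Qed.

(** * Structured programs *)

(* [Unless r c] runs [c] if register [r] is 0, and [Repeat c r] runs [c] until
   [r] is 0, at least once: each compiles to a single conditional jump, the only
   kind of jump that the machine has. *)
Inductive cmd :=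
| Do of instr
| Seq of cmd & cmd
| Unless of nat & cmd
| Repeat of cmd & nat.

Fixpoint csize (c : cmd) : nat :=
  match c with
  | Do _ => 1
  | Seq a b => csize a + csize b
  | Unless _ a => (csize a).+1
  | Repeat a _ => (csize a).+1
  end.

(** Jump targets are absolute, hence the argument [o], the address where the code is placed. *)
Fixpoint code (o : nat) (c : cmd) : program :=
  match c with
  | Do i => [:: i]
  | Seq a b => code o a ++ code (o + csize a) b
  | Unless r a => IJpos r (o.+1 + csize a) :: code o.+1 a
  | Repeat a r => rcons (code o a) (IJpos r o)
  end.

Definition jumps (i : instr) : bool := if i is IJpos _ _ then true else false.

(** The last argument counts machine steps, conditional jumps included. Raw jumps have no
    evaluation, so every [Do] falls through to the next instruction. *)
Inductive ceval (inp : seq nat) : cmd -> (nat -> nat) -> (nat -> nat) -> nat -> Prop :=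
| CDo i m : ~~ jumps i -> ceval inp (Do i) m (reg (exec inp i (Config 0 m))) 1
| CSeq a b m m1 m2 k1 k2 :
    ceval inp a m m1 k1 -> ceval inp b m1 m2 k2 ->
    ceval inp (Seq a b) m m2 (k1 + k2)
| CUnlessRun r a m m1 k :
    m r = 0 -> ceval inp a m m1 k -> ceval inp (Unless r a) m m1 k.+1
| CUnlessSkip r a m : 0 < m r -> ceval inp (Unless r a) m m 1
| CRepeatStop a r m m1 k :
    ceval inp a m m1 k -> m1 r = 0 -> ceval inp (Repeat a r) m m1 k.+1
| CRepeatLoop a r m m1 m2 k1 k2 :
    ceval inp a m m1 k1 -> 0 < m1 r -> ceval inp (Repeat a r) m1 m2 k2 ->
    ceval inp (Repeat a r) m m2 (k1.+1 + k2).

Lemma size_code o c : size (code o c) = csize c.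
Proof.
elim: c o => [i|a IHa b IHb|r a IHa|a IHa r] o //=.
- by rewrite size_cat IHa IHb.
- by rewrite IHa.
- by rewrite size_rcons IHa.
Qed.

Lemma step_code inp P pre ins post m :
  P = pre ++ ins :: post ->
  step P inp (Config (size pre) m) = exec inp ins (Config (size pre) m).
Proof. by move=> ->; rewrite /step /= onth_cat ltnn subnn. Qed.

(** Induction on the evaluation; the surrounding code is arbitrary so that the hypotheses apply to
    subcommands in place. *)
Lemma code_correct inp c m m' k : ceval inp c m m' k ->
  forall P pre post, P = pre ++ code (size pre) c ++ post ->
  iter k (step P inp) (Config (size pre) m) = Config (size pre + csize c) m'.
Proof.
elim=> {c m m' k}
  [i m nj|a b m m1 m2 k1 k2 _ IHa _ IHb|r a m m1 k m0 _ IHa|r a m m0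
  |a r m m1 k _ IHa m0|a r m m1 m2 k1 k2 _ IHa m0 _ IHb] P pre post PE.
- by rewrite /= (step_code _ _ PE); case: i nj {PE} => //= *; rewrite addn1.
- rewrite addnC iterD (IHa P pre (code (size pre + csize a) b ++ post)); last first.
    by rewrite PE /= -!catA.
  have := IHb P (pre ++ code (size pre) a) post.
  rewrite size_cat size_code /= -addnA => -> //.
  by rewrite PE /= -!catA.
- rewrite iterSr (step_code _ _ PE) /= m0 /=.
  have := IHa P (rcons pre (IJpos r ((size pre).+1 + csize a))) post.
  by rewrite !size_rcons => ->; [rewrite addSnnS|rewrite PE cat_rcons].
- by rewrite /= (step_code _ _ PE) /= m0 addSnnS.
- rewrite /= (IHa P pre (IJpos r (size pre) :: post)); last by rewrite PE /= cat_rcons.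
  have := @step_code inp P (pre ++ code (size pre) a) (IJpos r (size pre)) post m1.
  rewrite size_cat size_code => -> /=; first by rewrite m0 addnS.
  by rewrite PE /= cat_rcons -catA.
(* The final jump returns to the start of the same loop, where the second induction hypothesis takes
   over. *)
- rewrite addnC iterD iterS (IHa P pre (IJpos r (size pre) :: post)); last first.
    by rewrite PE /= cat_rcons.
  have := @step_code inp P (pre ++ code (size pre) a) (IJpos r (size pre)) post m1.
  rewrite size_cat size_code => -> /=; first by rewrite m0 (IHb P pre post PE).
  by rewrite PE /= cat_rcons -catA.
Qed.

(* The postcondition sees the clock [t], so that it can bound the running time. *)
Definition wp (inp : seq nat) (c : cmd) (Q : (nat -> nat) -> nat -> Prop)
    (m : nat -> nat) (t : nat) : Prop :=
  exists m' k, ceval inp c m m' k /\ Q m' (t + k).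

Lemma decides_wp inp c T (R : Prop) :
  wp inp c (fun m t => t <= T /\ exists b : bool, m 0 = b /\ (b <-> R)) (fun=> 0) 0 ->
  decides_within (code 0 c) inp T R.
Proof.
move=> [m [k [ev [kT [b [m0 bR]]]]]]; exists k, b.
have := code_correct ev (P := code 0 c) (pre := [::]) (post := [::]).
rewrite cats0 => /(_ erefl); rewrite -[Config _ (fun=> 0)]/start => -> /=.
by split=> //; rewrite /halted size_code.
Qed.

(** * Proof rules for commands with a clock *)

Section WeakestPreconditions.

Variable inp : seq nat.

Local Notation memory := (nat -> nat).

Implicit Types (Q : memory -> nat -> Prop) (m : memory) (t : nat).

Lemma wp_mono c Q Q' m t :
  wp inp c Q m t -> (forall m' t', Q m' t' -> Q' m' t') -> wp inp c Q' m t.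
Proof. by move=> [m' [k [ev Qm]]] QQ'; exists m', k; split=> //; apply: QQ'. Qed.

Lemma wp_do i Q m t : ~~ jumps i ->
  Q (reg (exec inp i (Config 0 m))) t.+1 -> wp inp (Do i) Q m t.
Proof.
move=> nj Qm; exists (reg (exec inp i (Config 0 m))), 1; rewrite addn1.
by split=> //; apply: CDo.
Qed.

Lemma wp_const r n Q m t :
  Q (upd m r n) t.+1 -> wp inp (Do (IConst r n)) Q m t.
Proof. exact: wp_do. Qed.

Lemma wp_add r a b Q m t :
  Q (upd m r (m a + m b)) t.+1 -> wp inp (Do (IAdd r a b)) Q m t.
Proof. exact: wp_do. Qed.

Lemma wp_sub r a b Q m t :
  Q (upd m r (m a - m b)) t.+1 -> wp inp (Do (ISub r a b)) Q m t.
Proof. exact: wp_do. Qed.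

Lemma wp_load r a Q m t :
  Q (upd m r (m (m a))) t.+1 -> wp inp (Do (ILoad r a)) Q m t.
Proof. exact: wp_do. Qed.

Lemma wp_store a r Q m t :
  Q (upd m (m a) (m r)) t.+1 -> wp inp (Do (IStore a r)) Q m t.
Proof. exact: wp_do. Qed.

Lemma wp_read r a Q m t :
  Q (upd m r (nth 0 inp (m a))) t.+1 -> wp inp (Do (IRead r a)) Q m t.
Proof. exact: wp_do. Qed.

Lemma wp_seq a b Q m t :
  wp inp a (fun m' t' => wp inp b Q m' t') m t -> wp inp (Seq a b) Q m t.
Proof.
move=> [m1 [k1 [ev1 [m2 [k2 [ev2 Qm]]]]]]; exists m2, (k1 + k2).
by rewrite addnA; split=> //; apply: CSeq ev1 ev2.
Qed.

Lemma wp_unless r a Q m t :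
  (m r = 0 -> wp inp a Q m t.+1) -> (0 < m r -> Q m t.+1) ->
  wp inp (Unless r a) Q m t.
Proof.
move=> run_a skip_a; have [m0|m_gt0] := posnP (m r).
  have [m1 [k [ev Qm]]] := run_a m0; exists m1, k.+1; rewrite addnS.
  by split=> //; apply: CUnlessRun.
by exists m, 1; rewrite addn1; split; [apply: CUnlessSkip|apply: skip_a].
Qed.

(** The index n of the invariant is a variant: its strict decrease at each further pass gives
    termination. *)
Lemma wp_repeat a r (I : nat -> memory -> nat -> Prop) Q :
  (forall n m t, I n m t ->
     wp inp a (fun m' t' => if m' r == 0 then Q m' t'.+1
                            else exists n', n' < n /\ I n' m' t'.+1) m t) ->
  forall n m t, I n m t -> wp inp (Repeat a r) Q m t.
Proof.
move=> body n; elim/ltn_ind: n => n IHn m t Inmt.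
have [m1 [k [ev]]] := body n m t Inmt; case: ifPn => [/eqP m0 Qm|].
  by exists m1, k.+1; rewrite addnS; split=> //; apply: CRepeatStop.
rewrite -lt0n => m_gt0 [n' [n'n /(IHn _ n'n) [m2 [k2 [ev2 Qm]]]]].
exists m2, (k.+1 + k2); rewrite addnA addnS; split=> //.
exact: CRepeatLoop ev m_gt0 ev2.
Qed.

End WeakestPreconditions.

(** * The program *)

Coercion Do : instr >-> cmd.
Notation "a ;; b" := (Seq a b) (at level 60, right associativity).

(* The constants are p + 1 in [rPp], p in [rP], p + 2 in [rLen] and N in [rRows].
   From address 30 on, the memory contains a table with one row of length p + 2
   for each vertex v < N: the bits E(v, v + d) for d <= p, and then a mark telling
   whether v has been visited.  The table is followed, from address [rFin] on, by
   the queue of the search, from [rHead] to [rTail].  A vertex is represented by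
   the address of its row, which spares the multiplications. *)
Notation rAns := 0 (only parsing).
Notation rOne := 1 (only parsing).
Notation rZero := 2 (only parsing).
Notation rPp := 3 (only parsing).
Notation rP := 4 (only parsing).
Notation rLen := 5 (only parsing).
Notation rBase := 6 (only parsing).
Notation rRows := 7 (only parsing).
Notation rInit := 8 (only parsing).
Notation rFin := 9 (only parsing).
Notation rTail := 10 (only parsing).
Notation rHead := 11 (only parsing).
Notation rA := 12 (only parsing).
Notation rUp := 13 (only parsing).
Notation rBit := 14 (only parsing).
Notation rDown := 15 (only parsing).
Notation rDist := 16 (only parsing).
Notation rK := 17 (only parsing).
Notation rSt := 18 (only parsing).
Notation rF := 19 (only parsing).
Notation rG := 20 (only parsing).
Notation rH := 21 (only parsing).
Notation rM := 22 (only parsing).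
Notation rCnt := 23 (only parsing).
Notation rPtr := 24 (only parsing).
Notation rQ := 25 (only parsing).
Notation rW := 26 (only parsing).

Definition move r a : cmd := IAdd r a rZero.

(* A state q is stored as q + 1, and its 5 entries start at position 4 + 5q of the
   input; [five] computes 5(q + 1), the position of the transition under (1,1). *)
Definition five e : cmd := IAdd rW e e ;; IAdd rW rW rW ;; IAdd rW rW e.

Definition read_one_one dst e : cmd := five e ;; IRead dst rW.

Definition read_pad_one dst e : cmd :=
  five e ;; IAdd rW rW rOne ;; IAdd rW rW rOne ;; IRead dst rW.

Definition read_final dst e : cmd := five e ;; ISub rW rW rOne ;; IRead dst rW.

(** Adds x to r as many times as y says, destroying y. A [Repeat] runs at least once, so y = 0 is
    filtered out first: [rG] is 0 exactly if y is positive. *)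
Definition mult r x y : cmd :=
  ISub rG rOne y ;; Unless rG (Repeat (IAdd r r x ;; ISub y y rOne) y).

(* p is found by following the (<>,1)-tail of the initial state to its end. *)
Definition get_sizes : cmd :=
  IConst rOne 1 ;; IConst rW 3 ;; IRead rInit rW ;; IAdd rInit rInit rOne ;;
  move rSt rInit ;;
  Repeat (read_pad_one rSt rSt ;; IAdd rPp rPp rOne) rSt ;;
  ISub rP rPp rOne ;; IAdd rLen rPp rOne ;; IConst rBase 30 ;;
  IAdd rH rPp rP ;; move rK rP ;; mult rRows rH rK.

(* min(i, p + 1) is computed as i - (i - (p + 1)). *)
Definition get_start : cmd :=
  IRead rF rZero ;; IRead rK rOne ;; ISub rH rK rPp ;; ISub rK rK rH ;;
  mult rF rP rK ;; move rA rBase ;; mult rA rLen rF.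

(** The state in [rSt] walks along a (<>,1)-tail; whether it is final at distance d is the edge
    bit. *)
Definition fill_row : cmd :=
  Repeat (read_final rF rSt ;; IStore rPtr rF ;; IAdd rPtr rPtr rOne ;;
          read_pad_one rSt rSt ;; ISub rK rK rOne) rK.

(** [rQ] walks along the (1,1)-states, one row for each vertex; the advance of [rPtr] after the row
    jumps over the mark, which is still 0. *)
Definition fill : cmd :=
  move rPtr rBase ;; move rQ rInit ;; move rCnt rRows ;;
  Repeat (move rSt rQ ;; move rK rPp ;; fill_row ;;
          IAdd rPtr rPtr rOne ;; read_one_one rQ rQ ;; ISub rCnt rCnt rOne) rCnt.

Definition visit r : cmd :=
  IAdd rM r rPp ;; ILoad rF rM ;;
  Unless rF (IStore rM rOne ;; IStore rTail r ;; IAdd rTail rTail rOne).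

(* An edge to a vertex outside the table settles the answer. *)
Definition scan_up : cmd :=
  ILoad rF rBit ;; ISub rG rOne rF ;;
  Unless rG (ISub rH rFin rUp ;; Unless rH (IConst rAns 1) ;;
             ISub rG rOne rH ;; Unless rG (visit rUp)).

(** The edge between v - d and v is recorded in the row of v - d. For d > v the truncated address
    [rDown] falls below the base of the table, which the first test detects. *)
Definition scan_down : cmd :=
  IAdd rH rDown rOne ;; ISub rH rH rBase ;; ISub rG rOne rH ;;
  Unless rG (IAdd rH rDown rDist ;; ILoad rH rH ;; ISub rG rOne rH ;;
             Unless rG (visit rDown)).

Definition scan : cmd :=
  Repeat (scan_up ;; scan_down ;;
          IAdd rUp rUp rLen ;; IAdd rBit rBit rOne ;; ISub rDown rDown rLen ;;
          IAdd rDist rDist rOne ;; ISub rK rK rOne) rK.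

(** [rCnt] is the number of vertices queued but not yet scanned. *)
Definition search : cmd :=
  Repeat (ILoad rA rHead ;; IAdd rHead rHead rOne ;;
          move rUp rA ;; move rBit rA ;; move rDown rA ;; IConst rDist 0 ;;
          move rK rPp ;; scan ;; ISub rCnt rTail rHead) rCnt.

Definition infinity_test : cmd :=
  get_sizes ;; get_start ;; fill ;;
  move rFin rPtr ;; move rHead rPtr ;; move rTail rPtr ;; visit rA ;; search.

(** * Execution of straight-line code and of multiplication *)

Lemma upd_eq m r v : upd m r v r = v.
Proof. by rewrite /upd eqxx. Qed.

Lemma upd_ne m r v j : j != r -> upd m r v j = m j.
Proof. by rewrite /upd => /negPf ->. Qed.

Ltac rd := repeat first
  [ rewrite upd_eq | rewrite upd_ne; [|by []] | rewrite upd_ne; [|by lia] ].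

Ltac wp1 := first
  [ apply: wp_seq | apply: wp_add | apply: wp_sub | apply: wp_const
  | apply: wp_load | apply: wp_store | apply: wp_read ]; cbv beta; rd.

Lemma wp_mult inp r x y (Q : (nat -> nat) -> nat -> Prop) m t :
  uniq [:: r; x; y; rG; rOne] -> m rOne = 1 ->
  (forall m' t', (forall j, j != r -> j != y -> j != rG -> m' j = m j) ->
     m' r = m r + m x * m y -> t' <= t + 2 + 3 * m y -> Q m' t') ->
  wp inp (mult r x y) Q m t.
Proof.
rewrite /= !inE => rxy m1 mQ; rewrite /mult; do 2 wp1.
apply: wp_unless; rd; rewrite m1 => my; last first.
  by apply: mQ => [j *| |]; rd; nia.
(* The content of r plus x times the remaining count n is constant, and each pass costs 3 steps. *)
pose I n (m' : nat -> nat) t' := [/\ n = m' y, 0 < n,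
  forall j, j != r -> j != y -> j != rG -> m' j = m j,
  m' r + m x * n = m r + m x * m y & t' + 3 * n <= t + 2 + 3 * m y].
apply: (@wp_repeat _ _ _ I _ _ (m y)); last first.
  by split=> [||j *| |]; rd; lia.
move=> n m' t' [nE n_gt0 fr rE tE].
do 3 wp1.
have -> : m' 1 = 1 by rewrite fr //; lia.
have xE : m' x = m x by rewrite fr //; lia.
case: ifP => yn.
  by apply: mQ => [j *| |]; rd; [rewrite fr|nia|lia].
exists n.-1; split; first by lia.
by split=> [||j *| |]; rd; [lia|lia|rewrite fr|nia|lia].
Qed.

(** * Breadth-first search *)

Section BreadthFirstSearch.

Variables (inp : seq nat) (p N : nat) (e : nat -> nat -> bool).

Let L := p.+2.
Let row v := 30 + v * L.
Let queue := 30 + N * L.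

Definition push (s : seq nat) v := if v \in s then s else rcons s v.

(** The sequence [s] lists all vertices queued so far, scanned ones included: nothing is erased from
    the queue, so [s] is also the set of marked vertices. *)
Record heap (m : nat -> nat) (s : seq nat) : Prop := Heap {
  heap_table : forall v d, v < N -> d <= p -> m (row v + d) = e v d;
  heap_mark : forall v, v < N -> m (row v + p.+1) = (v \in s);
  heap_queue : forall j, j < size s -> m (queue + j) = row (nth 0 s j);
  heap_one : m rOne = 1;
  heap_zero : m rZero = 0;
  heap_pp : m rPp = p.+1;
  heap_len : m rLen = L;
  heap_base : m rBase = 30;
  heap_fin : m rFin = queue;
  heap_tail : m rTail = queue + size s
}.

Lemma row_queue v j : v < N -> j < L -> row v + j < queue.
Proof. by rewrite /row /queue /L => *; nia. Qed.

(** Euclidean division by the row length; it ensures that setting one mark disturbs no other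
    cell. *)
Lemma row_inj v v' j j' : j < L -> j' < L ->
  (row v + j == row v' + j') = (v == v') && (j == j').
Proof.
move=> jL jL'; apply/eqP/andP => [|[/eqP-> /eqP->] //].
rewrite /row -!addnA => /addnI eq_vj; split.
  by have := congr1 (divn^~ L) eq_vj; rewrite /= !divnMDl // !divn_small // !addn0 => ->.
by have := congr1 (modn^~ L) eq_vj; rewrite /= !modnMDl !modn_small // => ->.
Qed.

Lemma heap_upd m s r v :
  heap m s -> r < 30 -> r \notin [:: rOne; rZero; rPp; rLen; rBase; rFin; rTail] ->
  heap (upd m r v) s.
Proof.
case=> tab mark que h1 h0 hpp hL hb hf ht r30; rewrite !inE !negb_or => nr.
split; try (by rewrite upd_ne //; lia).
- by move=> u d uN dp; rewrite upd_ne ?tab //; rewrite /row; lia.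
- by move=> u uN; rewrite upd_ne ?mark //; rewrite /row; lia.
- by move=> j js; rewrite upd_ne ?que //; rewrite /queue; lia.
Qed.

(** The writes to the mark, to the end of the queue and to [rTail] fall in disjoint zones, so the
    other fields of [heap] survive. *)
Lemma wp_visit r s v (Q : (nat -> nat) -> nat -> Prop) m t :
  r \in [:: rA; rUp; rDown] -> heap m s -> v < N -> m r = row v ->
  (forall m' t',
     heap m' (push s v) ->
     (forall j, j < 30 -> j \notin [:: rF; rM; rTail] -> m' j = m j) ->
     t' <= t + 6 -> Q m' t') ->
  wp inp (visit r) Q m t.
Proof.
move=> r_in hp vN mr mQ.
have r_ne j : j \in [:: rF; rM; rTail; rOne] -> r != j.
  by move: r_in; rewrite !inE => /or3P[] /eqP-> /or4P[] /eqP->.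
have row30 : 30 <= row v by rewrite /row; lia.
rewrite /visit; do 2 wp1; rewrite mr (heap_pp hp); do 2 wp1.
rewrite (heap_mark hp vN).
have row_v := @row_queue v p.+1 vN (leqnn _).
apply: wp_unless; rd.
  move=> /eqP; rewrite eqb0 => vs.
  have r30 : r != row v + p.+1.
    by move: r_in; rewrite !inE => /or3P[] /eqP->; lia.
  do 4 wp1; rewrite (upd_ne _ _ (r_ne 19 _)) // (upd_ne _ _ (r_ne 22 _)) //.
  rewrite mr (heap_tail hp) (heap_one hp).
  wp1; rewrite (heap_tail hp) (heap_one hp).
  apply: mQ; last by lia.
    rewrite /push (negPf vs).
    case: hp => tab mark que h1 h0 hpp hL hb hf ht.
    split; rewrite ?size_rcons; try (by rd; rewrite ?h1 ?ht //; lia).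
    - move=> u d uN dp; have uq := @row_queue u d uN (leqW dp).
      rewrite upd_ne; last by rewrite /row; lia.
      rewrite upd_ne; last by lia.
      rewrite upd_ne; last by rewrite row_inj /L; lia.
      rewrite !upd_ne ?tab //; rewrite /row; lia.
    - move=> u uN; have uq := @row_queue u p.+1 uN (leqnn _).
      rewrite upd_ne; last by rewrite /row; lia.
      rewrite upd_ne; last by lia.
      rewrite mem_rcons inE; have [->|ne_uv] := eqVneq u v; first by rewrite upd_eq.
      rewrite upd_ne; last by rewrite row_inj /L ?eqxx ?andbT.
      by rewrite !upd_ne ?mark // /row; lia.
    - move=> j; rewrite ltnS leq_eqVlt nth_rcons.
      rewrite upd_ne; last by rewrite /queue; lia.
      case: ltngtP => //= jE _; first last.
        by rewrite jE /= upd_eq.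
      rewrite upd_ne; last by lia.
      rewrite upd_ne; last by rewrite -/queue; lia.
      by rewrite !upd_ne ?que // /queue; lia.
  move=> j j30; rewrite !inE !negb_or => /and3P[nF nM nT].
  by rewrite !upd_ne // -?/queue; rewrite /queue; lia.
rewrite lt0b => vs; apply: mQ; last by lia.
  by rewrite /push vs; do ![apply: heap_upd => //].
by move=> j j30; rewrite !inE !negb_or => /and3P[nF nM nT]; rewrite !upd_ne.
Qed.

(** Frames are lists of registers, so that disequalities between registers become membership tests
    settled by computation. *)
Lemma upd_frame (rs : seq nat) j : j \notin rs ->
  forall m r v, r \in rs -> upd m r v j = m j.
Proof. by move=> jn m r v r_in; apply: upd_ne; apply: contraNneq jn => ->. Qed.

Lemma frame_sub (rs rs' : seq nat) j : j \notin rs' -> all (mem rs') rs -> j \notin rs.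
Proof. by move=> jn /allP sub; apply: contraNN jn => /sub. Qed.

Ltac frame :=
  let j := fresh "j" in let jn := fresh "jn" in intros j ? jn;
  rewrite ?(upd_frame jn) //.

Definition scan_up_frame := [:: rAns; rF; rG; rH; rM; rTail].

Lemma wp_scan_up s v d (Q : (nat -> nat) -> nat -> Prop) m t :
  heap m s -> v < N -> d <= p -> m rUp = row (v + d) -> m rBit = row v + d ->
  (forall m' t',
     heap m' (if e v d && (v + d < N) then push s (v + d) else s) ->
     m' rAns = (if e v d && (N <= v + d) then 1 else m rAns) ->
     (forall j, j < 30 -> j \notin scan_up_frame -> m' j = m j) ->
     t' <= t + 14 -> Q m' t') ->
  wp inp scan_up Q m t.
Proof.
move=> hp vN dp mup mbit mQ; rewrite /scan_up; do 4 wp1.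
rewrite mbit (heap_table hp vN dp) (heap_one hp).
apply: wp_unless; rd; last first.
  rewrite subn_gt0 ltnS leqn0 eqb0 => /negPf evd.
  apply: mQ; rewrite ?evd /=; last by lia.
  - by do ![apply: heap_upd => //].
  - by rd.
  - by frame.
move=> /eqP; rewrite subn_eq0 lt0b => evd; rewrite evd /= in mQ *.
do 3 wp1; rewrite (heap_fin hp) mup.
(* Rows have equal length, so comparing the address of a row with the end of the table compares the
   vertex with N. *)
have lt_row : (queue - row (v + d) == 0) = (N <= v + d).
  by rewrite /queue /row subn_eq0 leq_add2l leq_mul2r.
have ltE : (queue - row (v + d) == 0) = ~~ (v + d < N) by rewrite lt_row -leqNgt.
apply: wp_unless; rd; [move=> /eqP|rewrite lt0n].
  rewrite lt_row => N_le; do 3 wp1; rewrite (heap_one hp).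
  have /eqP q0 : queue - row (v + d) == 0 by rewrite lt_row.
  rewrite q0; apply: wp_unless; rd; [by []|move=> _].
  apply: mQ; rewrite ?N_le 1?ltnNge ?N_le /=; last by lia.
  - by do ![apply: heap_upd => //].
  - by rd.
  - by frame.
rewrite ltE negbK => vdN; do 2 wp1; rewrite (heap_one hp).
apply: wp_unless; rd; [move=> _|by move: ltE; rewrite vdN; lia].
apply: (@wp_visit _ s (v + d)) => //; first by do ![apply: heap_upd => //].
have N_vd : (N <= v + d) = false by apply/negbTE; rewrite -ltnNge.
rewrite vdN N_vd in mQ; move=> m' t' hp' fr tE; apply: mQ.
- exact: hp'.
- by rewrite fr //; rd.
- by move=> j j30 jn; rewrite fr ?(frame_sub jn) // !(upd_frame jn).
- by lia.
Qed.

Lemma wp_scan_down s v d (Q : (nat -> nat) -> nat -> Prop) m t :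
  heap m s -> v < N -> d <= p -> m rDown = row v - d * L -> m rDist = d ->
  (forall m' t',
     heap m' (if (d <= v) && e (v - d) d then push s (v - d) else s) ->
     (forall j, j < 30 -> j \notin behead scan_up_frame -> m' j = m j) ->
     t' <= t + 14 -> Q m' t') ->
  wp inp scan_down Q m t.
Proof.
move=> hp vN dp mdn md mQ; rewrite /scan_down; do 6 wp1.
rewrite (heap_one hp) (heap_base hp) mdn.
(* If d > v, the truncated difference is less than the base 30; otherwise it is the address of a
   row, and adding 1 makes the test positive even for row 0. *)
have le_row : (row v - d * L + 1 - 30 == 0) = ~~ (d <= v).
  by rewrite /row -ltnNge; apply/eqP/idP; rewrite /L; nia.
apply: wp_unless; rd; [move=> /eqP|]; last first.
  rewrite subn_gt0 ltnS leqn0 le_row => /negPf dv.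
  apply: mQ; rewrite ?dv /=; last by lia.
  - by do ![apply: heap_upd => //].
  - by frame.
rewrite subn_eq0 lt0n le_row negbK => dv; rewrite dv /= in mQ.
have row_sub : row v - d * L = row (v - d).
  by rewrite /row mulnBl addnBA // leq_mul2r dv orbT.
rewrite row_sub; do 2 wp1; rewrite mdn md row_sub.
have vdN : v - d < N by lia.
have row_ge : 30 <= row (v - d) by rewrite leq_addr.
do 2 wp1; rewrite (heap_table hp vdN dp); do 2 wp1; rewrite (heap_one hp).
apply: wp_unless; rd; [move=> /eqP|]; last first.
  rewrite subn_gt0 ltnS leqn0 eqb0 => /negPf evd.
  apply: mQ; rewrite ?evd /=; last by lia.
  - by do ![apply: heap_upd => //].
  - by frame.
rewrite subn_eq0 lt0b => evd.
apply: (@wp_visit _ s (v - d)) => //; first by do ![apply: heap_upd => //].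
  by rd; rewrite mdn.
rewrite evd in mQ; move=> m' t' hp' fr tE; apply: mQ.
- exact: hp'.
- by move=> j j30 jn; rewrite fr ?(frame_sub jn) // !(upd_frame jn).
- by lia.
Qed.

Lemma mem_push s v u : (u \in push s v) = (u == v) || (u \in s).
Proof.
rewrite /push; case: ifP => vs; last by rewrite mem_rcons inE.
by case: eqP => // ->; rewrite vs.
Qed.

Lemma prefix_push s v : prefix s (push s v).
Proof. by rewrite /push; case: ifP => _; rewrite ?prefix_refl // -cats1 prefix_prefix. Qed.

Lemma push_uniq s v : uniq s -> uniq (push s v).
Proof. by rewrite /push; case: ifP => // vs us; rewrite rcons_uniq vs. Qed.

Lemma prefix_mem (s s' : seq nat) u : prefix s s' -> u \in s -> u \in s'.
Proof. by move=> /prefixP[s2 ->] us; rewrite mem_cat us. Qed.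

Lemma prefix_nth (s s' : seq nat) k : prefix s s' -> k < size s -> nth 0 s' k = nth 0 s k.
Proof. by move=> /prefixP[s2 ->] ks; rewrite nth_cat ks. Qed.

Lemma prefix_size (s s' : seq nat) : prefix s s' -> size s <= size s'.
Proof. by move=> /prefixP[s2 ->]; rewrite size_cat leq_addr. Qed.

(** * Soundness and completeness of the search *)

Variables (E : relation nat) (v0 : nat).
Hypothesis joinedP : forall v u, E v u <-> joined e v u.
Hypothesis e_le : forall v d, e v d -> d <= p.
Hypothesis v0_lt : v0 < N.

(** The bit b is the current answer. Only one direction of its correctness is kept here; the other
    comes from [explored] once the queue is exhausted. *)
Record sound (s : seq nat) (b : bool) : Prop := Sound {
  sound_uniq : uniq s;
  sound_lt : forall v, v \in s -> v < N;
  sound_comp : forall v, v \in s -> component E v0 v;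
  sound_ans : b -> exists u, component E v0 u /\ N <= u
}.

(** The two inequalities say that u and v are at distance less than d. A neighbour outside the table
    must have set the answer. *)
Definition explored (s : seq nat) (b : bool) v d :=
  forall u, joined e v u -> u < v + d -> v < u + d -> if u < N then u \in s else b.

Lemma explored_mono s s' b b' v d :
  prefix s s' -> b ==> b' -> explored s b v d -> explored s' b' v d.
Proof.
move=> ss' bb' ex u vu lt1 lt2; have := ex u vu lt1 lt2; case: ifP => _.
  exact: prefix_mem.
by apply/implyP.
Qed.

Lemma sound_push s b v u :
  sound s b -> v \in s -> joined e v u -> u < N -> sound (push s u) b.
Proof.
move=> [us ltN cmp ans] vs vu uN; split=> //.
- exact: push_uniq.
- by move=> w; rewrite mem_push => /orP[/eqP->|/ltN].
- move=> w; rewrite mem_push => /orP[/eqP->|/cmp //].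
  by apply: (rt_trans _ _ _ v); [exact: cmp|apply: rt_step; apply/joinedP].
Qed.

Lemma sound_answer s b v u :
  sound s b -> v \in s -> joined e v u -> N <= u -> sound s true.
Proof.
move=> [us ltN cmp ans] vs vu uN; split=> // _; exists u; split=> //.
by apply: (rt_trans _ _ _ v); [exact: cmp|apply: rt_step; apply/joinedP].
Qed.

Definition scan_frame := rUp :: rBit :: rDown :: rDist :: rK :: scan_up_frame.

Lemma joined_up v d : joined e v (v + d) = e v d.
Proof. by rewrite /joined leq_addr addKn. Qed.

Lemma joined_down v d : d <= v -> joined e v (v - d) = e (v - d) d.
Proof.
move=> dv; rewrite /joined; case: leqP => [|_]; last by rewrite subKn.
by case: d dv => [|d] dv; rewrite ?subn0 ?subnn //; lia.
Qed.

(** The only new candidates are v + d and v - d, and the latter is always in the table. *)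
Lemma explored_step s s' b b' v d :
  v < N -> prefix s s' -> b ==> b' -> explored s b v d ->
  (e v d -> if v + d < N then v + d \in s' else b') ->
  (d <= v -> e (v - d) d -> v - d \in s') ->
  explored s' b' v d.+1.
Proof.
move=> vN ss' bb' ex up down u vu u_lt v_lt.
have [u1|u1] := ltnP u (v + d); last first.
  have uE : u = v + d by lia.
  by rewrite uE joined_up in vu *; apply: up.
have [v1|v1] := ltnP v (u + d); first exact: (explored_mono ss' bb' ex).
have uE : u = v - d by lia.
have dv : d <= v by lia.
rewrite (_ : u < N); last by lia.
by rewrite uE joined_down // in vu *; apply: down.
Qed.

Lemma wp_scan s b v (Q : (nat -> nat) -> nat -> Prop) m t :
  heap m s -> sound s b -> v \in s -> m rAns = b ->
  m rUp = row v -> m rBit = row v -> m rDown = row v -> m rDist = 0 ->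
  m rK = p.+1 ->
  (forall m' t' s' b',
     heap m' s' -> sound s' b' -> prefix s s' -> b ==> b' -> m' rAns = b' ->
     explored s' b' v p.+1 ->
     (forall j, j < 30 -> j \notin scan_frame -> m' j = m j) ->
     t' <= t + 34 * p.+1 -> Q m' t') ->
  wp inp scan Q m t.
Proof.
move=> hp snd vs ans mup mbit mdn md mk mQ.
(* The distances below d are done and n remain. Each costs at most 34 steps: 14 upwards, 14
   downwards, 5 updates and the jump. *)
pose I n (m' : nat -> nat) t' := exists s' (b' : bool) d,
  [/\ [/\ n + d = p.+1, 0 < n & t' + 34 * n <= t + 34 * p.+1],
      [/\ heap m' s', sound s' b', prefix s s' & b ==> b'],
      m' rAns = b' /\ explored s' b' v d,
      [/\ m' rUp = row (v + d), m' rBit = row v + d, m' rDown = row v - d * L,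
          m' rDist = d & m' rK = n]
    & forall j, j < 30 -> j \notin scan_frame -> m' j = m j].
apply: (@wp_repeat _ _ _ I _ _ p.+1); last first.
  exists s, b, 0; split=> //; first by rewrite addn0.
    by split; rewrite ?prefix_refl ?implybb.
  by split=> // u _; lia.
  by rewrite addn0 subn0 addn0.
move=> {mup mbit mdn md mk hp ans} n m1 t1 [s1 [b1 [d]]].
case=> [[nd n_gt0 t1E] [hp1 snd1 ss1 bb1] [ans1 ex1] [mup mbit mdn md mk] fr1].
have dp : d <= p by lia.
have vs1 := prefix_mem ss1 vs.
have vN := sound_lt snd1 vs1.
apply: wp_seq; apply: (wp_scan_up hp1 vN dp mup mbit) => m2 t2.
set s2 := (if _ then _ else _) => hp2 ans2 fr2 t2E.
pose b2 := b1 || (e v d && (N <= v + d)).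
have snd2 : sound s2 b2.
  rewrite /s2 /b2; case evd: (e v d); rewrite /= ?orbF //.
  have [vdN|Nvd] /= := ltnP; rewrite ?orbF ?orbT.
    by apply: (sound_push snd1 vs1); rewrite ?joined_up.
  by apply: (sound_answer snd1 vs1 _ Nvd); rewrite joined_up.
have ss2 : prefix s1 s2 by rewrite /s2; case: ifP => _; rewrite ?prefix_push ?prefix_refl.
have {}ans2 : m2 rAns = b2 by rewrite ans2 ans1 /b2; case: (e v d && _); rewrite ?orbT ?orbF.
have mdn2 : m2 rDown = row v - d * L by rewrite fr2.
have md2 : m2 rDist = d by rewrite fr2.
apply: wp_seq; apply: (wp_scan_down hp2 vN dp mdn2 md2) => m3 t3.
set s3 := (if _ then _ else _) => hp3 fr3 t3E.
have snd3 : sound s3 b2.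
  rewrite /s3; case: ifP => // /andP[dv evd].
  by apply: (sound_push snd2 (prefix_mem ss2 vs1)); rewrite ?joined_down //;
    apply: leq_ltn_trans (leq_subr _ _) vN.
have ss3 : prefix s2 s3 by rewrite /s3; case: ifP => _; rewrite ?prefix_push ?prefix_refl.
have ss13 : prefix s1 s3 by apply: prefix_trans ss3.
have bb12 : b1 ==> b2 by rewrite /b2; case: (b1).
have ex3 : explored s3 b2 v d.+1.
  apply: (explored_step vN ss13 bb12 ex1) => [evd|dv evd]; last first.
    by rewrite /s3 dv evd mem_push eqxx.
  case: ltnP => [vdN|Nvd]; last by rewrite /b2 evd Nvd orbT.
  by apply: (prefix_mem ss3); rewrite /s2 evd vdN /= mem_push eqxx.
have m3E j : j < 30 -> j \notin scan_up_frame -> m3 j = m1 j.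
  by move=> j30 jn; rewrite fr3 ?fr2 ?(frame_sub jn).
do 9 wp1.
rewrite (heap_len hp3) (heap_one hp3) !m3E // mup mbit mdn md mk.
set m4 := (upd _ _ _).
have hp4 : heap m4 s3 by rewrite /m4; do ![apply: heap_upd => //].
have fr4 j : j < 30 -> j \notin scan_frame -> m4 j = m j.
  by move=> j30 jn; rewrite -fr1 // /m4 !(upd_frame jn) // m3E ?(frame_sub jn).
have ans4 : m4 rAns = b2 by rewrite /m4; rd; rewrite fr3.
have ss4 : prefix s s3 := prefix_trans ss1 ss13.
have bb2 : b ==> b2 by move: bb1; rewrite /b2; case: (b) (b1) => [] [].
have t4E : t3.+1.+4.+1 + 34 * n.-1 <= t + 34 * p.+1.
  by clear -t1E t2E t3E n_gt0; lia.
have reg4 : [/\ m4 rUp = row (v + d.+1), m4 rBit = row v + d.+1,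
    m4 rDown = row v - d.+1 * L, m4 rDist = d.+1 & m4 rK = n.-1].
  rewrite /m4; split; rd => //.
  - by rewrite [v + d.+1]addnS /row mulSn [L + _]addnC addnA.
  - by rewrite addn1 addnS.
  - by rewrite mulSn [L + _]addnC subnDA.
  - by rewrite addn1.
  - by rewrite subn1.
clearbody m4; clear m3E fr3 hp3 fr2 hp2 fr1 hp1.
rewrite subn1; case: ifP => [/eqP n0|/negbT n0].
  have pE : p.+1 = d.+1 by clear -nd n_gt0 n0; lia.
  rewrite -pE in ex3; apply: (mQ m4 _ s3 b2 hp4 snd3 ss4 bb2 ans4 ex3 fr4).
  by move: t4E; rewrite n0 muln0 addn0.
exists n.-1; split; first by rewrite prednK.
exists s3, b2, d.+1; split; [|by []|by []|exact: reg4|exact: fr4].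
by split; [clear -nd n_gt0; lia|rewrite lt0n|].
Qed.

(** This bounds the number of rounds of the search. *)
Lemma size_sound s b : sound s b -> size s <= N.
Proof.
move=> [us ltN _ _]; rewrite -(size_iota 0 N); apply: uniq_leq_size => // v /ltN.
by rewrite mem_iota.
Qed.

(** If the answer bit is 0, the queue is closed under adjacency, edges having length at most p; it
    then contains the whole component, which stays below N. *)
Lemma explored_answer s b :
  sound s b -> v0 \in s -> (forall v, v \in s -> explored s b v p.+1) ->
  b <-> exists u, component E v0 u /\ N <= u.
Proof.
move=> snd v0s ex; split; first exact: (sound_ans snd).
case=> u [v0u Nu]; apply: contraLR Nu => nb; rewrite -ltnNge.
apply: (sound_lt snd); elim: (clos_rt_rtn1 _ _ _ _ v0u) => // {v0u}v w vw _ vs.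
have := ex v vs w; rewrite -joinedP => /(_ vw).
have [w_le v_le] : w < v + p.+1 /\ v < w + p.+1.
  by move/joinedP: vw; rewrite /joined; case: (leqP v w) => ? /e_le; lia.
by rewrite (negPf nb) w_le v_le => /(_ isT isT); case: ifP.
Qed.

Lemma wp_search (Q : (nat -> nat) -> nat -> Prop) m t :
  heap m [:: v0] -> m rAns = 0 -> m rHead = queue ->
  (forall (m' : nat -> nat) t' (b : bool),
     m' rAns = b -> (b <-> exists u, component E v0 u /\ N <= u) ->
     t' <= t + N * (34 * p.+1 + 9) -> Q m' t') ->
  wp inp search Q m t.
Proof.
move=> hp ans mhd mQ.
(* The first h queue entries have been scanned, so at most N - h rounds remain; 9 is the cost of a
   round outside [scan]. *)
pose I n (m' : nat -> nat) t' := exists s (b : bool) h,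
  [/\ [/\ n = N - h, h < size s & t' + n * (34 * p.+1 + 9) <= t + N * (34 * p.+1 + 9)],
      [/\ heap m' s, sound s b & v0 \in s], m' rAns = b, m' rHead = queue + h
    & forall k, k < h -> explored s b (nth 0 s k) p.+1].
apply: (@wp_repeat _ _ _ I _ _ N); last first.
  exists [:: v0], false, 0; split=> //; [by rewrite subn0| |by rewrite addn0].
  split; [exact: hp| |by rewrite inE].
  split=> // v; rewrite inE => /eqP->; [exact: v0_lt|exact: rt_refl].
move=> {hp ans mhd} n m1 t1 [s [b [h [[nE hs t1E] [hp snd v0s] ans mhd ex]]]].
have hs_in : nth 0 s h \in s by apply: mem_nth.
have sN := size_sound snd.
do 14 wp1; rewrite (heap_zero hp) (heap_pp hp) (heap_one hp) mhd !addn0.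
rewrite (heap_queue hp hs); apply: wp_seq.
set m2 := upd _ _ _.
have hp2 : heap m2 s by rewrite /m2; do ![apply: heap_upd => //].
have ans2 : m2 rAns = b by rewrite /m2; rd.
have hd2 : m2 rHead = queue + h.+1 by rewrite /m2; rd; rewrite addn1 addnS.
have [u2 b2 d2 i2 k2] : [/\ m2 rUp = row (nth 0 s h), m2 rBit = row (nth 0 s h),
    m2 rDown = row (nth 0 s h), m2 rDist = 0 & m2 rK = p.+1].
  by rewrite /m2; split; rd.
clearbody m2; apply: (wp_scan hp2 snd hs_in ans2 u2 b2 d2 i2 k2).
move=> m3 t3 s' b' hp3 snd' ss' bb' ans3 ex' fr3 t3E.
have hs' : h < size s' := leq_trans hs (prefix_size ss').
have ex_lt k : k < h.+1 -> explored s' b' (nth 0 s' k) p.+1.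
  rewrite ltnS leq_eqVlt => /orP[/eqP->|kh]; first by rewrite (prefix_nth ss' hs).
  rewrite (prefix_nth ss' (ltn_trans kh hs)).
  exact: (explored_mono ss' bb' (ex k kh)).
have sN' := size_sound snd'.
have t3N : t3.+2 + (N - h.+1) * (34 * p.+1 + 9) <= t + N * (34 * p.+1 + 9).
  apply: leq_trans t1E; rewrite nE (_ : N - h = (N - h.+1).+1).
    by rewrite mulSn; move: t3E; clear; lia.
  by clear -hs' sN'; lia.
wp1; rewrite (heap_tail hp3) fr3 // hd2.
have cntE : queue + size s' - (queue + h.+1) = size s' - h.+1.
  by rewrite subnDl.
rewrite cntE; case: ifP => [|/negbT]; rewrite subn_eq0 => s'h.
  apply: (mQ _ _ b'); [by rd| |exact: leq_trans (leq_addr _ _) t3N].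
  apply: (explored_answer snd'); first exact: (prefix_mem ss').
  move=> v /(nthP 0)[k ks <-]; apply: ex_lt; exact: leq_trans ks s'h.
exists (N - h.+1); split; first by clear -nE hs sN; lia.
exists s', b', h.+1; split; [| |by rd|by rd; rewrite fr3|exact: ex_lt].
- by split; [|rewrite ltnNge|].
- by split; [do ![apply: heap_upd => //]|exact: snd'|exact: (prefix_mem ss')].
Qed.

End BreadthFirstSearch.

(** * Filling the table *)

Section Initialization.

Variables (A : dfa) (p x i : nat).

Let inp := [:: x; i] ++ encode_dfa A.

Hypothesis p_gt0 : 0 < p.
Hypothesis runs : forall v d, d <= p -> run (init A) (nseq v L11 ++ nseq d Ld1) != None.
Hypothesis runs_end : run (init A) (nseq p.+1 Ld1) = None.

Definition reached w := encode_target (run (init A) w).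

(** With q stored as q + 1, position 5(q + 1) + j is entry j + 1 of q: the (1,1)-transition for j =
    0, the (<>,1)-transition for j = 2. *)
Lemma read_reached w j a : run (init A) w != None -> a \in [:: L11; Ld1] ->
  j = (if a.1 then 0 else 2) ->
  nth 0 inp (5 * reached w + j) = reached (rcons w a).
Proof.
rewrite /reached run_rcons; case: (run (init A) w) => [q|] // _ a_in ->.
have -> k : 5 * encode_target (Some q) + k = 4 + (q * 5 + k.+1).
  by rewrite [encode_target _]/=; lia.
rewrite /inp nth_encode_dfa; last by case: (a.1).
by move: a_in; rewrite !inE => /orP[] /eqP->.
Qed.

Lemma read_accepts w : run (init A) w != None ->
  nth 0 inp (5 * reached w - 1) = accepts A w.
Proof.
rewrite /reached /accepts; case: (run (init A) w) => [q|] // _.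
have -> : 5 * encode_target (Some q) - 1 = 4 + (q * 5 + 0).
  by rewrite [encode_target _]/=; lia.
by rewrite /inp nth_encode_dfa.
Qed.

Lemma wp_read_pad_one dst e (Q : (nat -> nat) -> nat -> Prop) m t :
  e != rW -> m rOne = 1 ->
  (forall m', (forall j, j \notin [:: rW; dst] -> m' j = m j) ->
     m' dst = nth 0 inp (5 * m e + 2) -> Q m' (t + 6)) ->
  wp inp (read_pad_one dst e) Q m t.
Proof.
move=> ew m1 mQ; rewrite /read_pad_one /five; do 2 apply: wp_seq.
do 9 wp1; rewrite m1 (_ : t.+1.+4.+1 = t + 6); last by lia.
apply: mQ.
  by move=> j jn; rewrite !(upd_frame jn) ?inE ?eqxx ?orbT.
by rewrite upd_eq; congr (nth 0 inp _); lia.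
Qed.

Lemma wp_read_one_one dst e (Q : (nat -> nat) -> nat -> Prop) m t :
  e != rW ->
  (forall m', (forall j, j \notin [:: rW; dst] -> m' j = m j) ->
     m' dst = nth 0 inp (5 * m e + 0) -> Q m' (t + 4)) ->
  wp inp (read_one_one dst e) Q m t.
Proof.
move=> ew mQ; rewrite /read_one_one /five; do 2 apply: wp_seq.
do 5 wp1; rewrite (_ : t.+4 = t + 4); last by lia.
apply: mQ.
  by move=> j jn; rewrite !(upd_frame jn) ?inE ?eqxx ?orbT.
by rewrite upd_eq; congr (nth 0 inp _); lia.
Qed.

Lemma wp_read_final dst e (Q : (nat -> nat) -> nat -> Prop) m t :
  e != rW -> m rOne = 1 ->
  (forall m', (forall j, j \notin [:: rW; dst] -> m' j = m j) ->
     m' dst = nth 0 inp (5 * m e - 1) -> Q m' (t + 5)) ->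
  wp inp (read_final dst e) Q m t.
Proof.
move=> ew m1 mQ; rewrite /read_final /five; do 2 apply: wp_seq.
do 7 wp1; rewrite m1 (_ : t.+1.+4 = t + 5); last by lia.
apply: mQ.
  by move=> j jn; rewrite !(upd_frame jn) ?inE ?eqxx ?orbT.
by rewrite upd_eq; congr (nth 0 inp _); lia.
Qed.

Let N := p.*2.+1 * p.
Let row v := 30 + v * p.+2.

Record initialized (m : nat -> nat) : Prop := Initialized {
  ini_ans : m rAns = 0;
  ini_one : m rOne = 1;
  ini_zero : m rZero = 0;
  ini_pp : m rPp = p.+1;
  ini_p : m rP = p;
  ini_len : m rLen = p.+2;
  ini_base : m rBase = 30;
  ini_rows : m rRows = N;
  ini_init : m rInit = reached [::]
}.

(** By [runs] and [runs_end] the walk along the (<>,1)-tail of the initial state first meets the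
    code 0 after p + 1 readings, where the counter stops. *)
Lemma wp_get_sizes (Q : (nat -> nat) -> nat -> Prop) :
  (forall m t, initialized m -> (forall a, 30 <= a -> m a = 0) ->
     t <= 11 * p + 30 -> Q m t) ->
  wp inp get_sizes Q (fun=> 0) 0.
Proof.
move=> mQ; rewrite /get_sizes; do 10 wp1.
(* Position 3 of the input holds the initial state, and adding 1 gives its code. *)
set q := nth 0 inp 3 + 1; rewrite !addn0; apply: wp_seq.
have qE : q = reached [::] by rewrite /q /reached /= addn1.
set m := upd _ _ _.
pose I n (m' : nat -> nat) t' := exists d,
  [/\ n = p.+1 - d /\ d <= p, m' rSt = reached (nseq d Ld1), m' rPp = d,
      forall j, j \notin [:: rSt; rPp; rW] -> m' j = m j & t' <= 5 + 8 * d].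
have m1 : m rOne = 1 by rewrite /m; rd.
have nz j : j \notin [:: rSt; rInit; rW; rOne] -> m j = 0.
  by move=> jn; rewrite /m !(upd_frame jn).
have mI : m rInit = q by rewrite /m; rd.
have mSt : m rSt = q by rewrite /m; rd.
apply: (@wp_repeat _ _ _ I _ _ p.+1); last first.
  by exists 0.
clearbody m; move=> n m2 t2 [d [[nE dp] st pp fr t2E]].
apply: wp_seq; apply: wp_read_pad_one => //; first by rewrite fr.
move=> m3 fr3 st3; wp1.
have run_d : run (init A) (nseq d Ld1) != None by have := runs 0 dp.
have {}st3 : m3 rSt = reached (nseq d.+1 Ld1).
  by rewrite st3 st (read_reached (a := Ld1)) // nseq_rcons.
rewrite (fr3 3) // pp (fr3 1) // fr // m1 addn1 st3.
have fr4 j : j \notin [:: rSt; rPp; rW] -> upd m3 3 d.+1 j = m j.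
  by move=> jn; rewrite !(upd_frame jn) // fr3 ?fr // (frame_sub jn).
case: ifP => [st0|st_n0]; last first.
  exists (p.+1 - d.+1); split; first by lia.
  exists d.+1; split=> //; [split=> //|lia].
  rewrite leqNgt; apply/negP => pd; move: st_n0; rewrite (_ : d.+1 = p.+1); last by lia.
  by rewrite /reached runs_end.
have dE : d = p.
  apply/eqP; rewrite eqn_leq dp leqNgt; apply/negP => lt_dp.
  have := runs 0 lt_dp; move: st0; rewrite /reached cat0s.
  by case: (run _ _).
move: t2E; rewrite {}dE in st3 fr4 *; move=> t2E.
set m4 := upd m3 3 _; have pp4 : m4 rPp = p.+1 by rewrite /m4; rd.
rewrite -/m4 in fr4; clearbody m4.
have m41 : m4 rOne = 1 by rewrite fr4.
have m40 j : j \notin [:: rSt; rPp; rW; rInit; rOne] -> m4 j = 0.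
  by move=> jn; rewrite fr4 ?nz // (frame_sub jn).
have m4I : m4 rInit = reached [::] by rewrite fr4 // mI.
do 10 wp1; rewrite m41 pp4 subn1 addn1 /= m40 //.
apply: wp_mult => //.
move=> m5 t5 fr5; rd; rewrite m40 // add0n => rows t5E.
apply: mQ; [split|..].
- by rewrite fr5 //; rd; rewrite m40.
- by rewrite fr5 //; rd.
- by rewrite fr5 //; rd; rewrite m40.
- by rewrite fr5 //; rd.
- by rewrite fr5 //; rd.
- by rewrite fr5 //; rd.
- by rewrite fr5 //; rd.
- by rewrite rows addn0 addSn addnn.
- by rewrite fr5 //; rd.
- by move=> a a30; rewrite fr5; [rd; rewrite m40 // !inE; lia|lia..].
- by lia.
Qed.

Lemma wp_get_start (Q : (nat -> nat) -> nat -> Prop) m t :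
  x < p -> initialized m -> (forall a, 30 <= a -> m a = 0) ->
  (forall m' t', initialized m' -> (forall a, 30 <= a -> m' a = 0) ->
     m' rA = row (vertex p x (minn i p.+1)) ->
     t' <= t + 10 + 3 * p.+1 + 3 * N -> Q m' t') ->
  wp inp get_start Q m t.
Proof.
move=> x_lt [m0 m1 m2 m3 m4 m5 m6 m7 m8] z mQ; rewrite /get_start; do 8 wp1.
rewrite m1 m2 m3 /= -minnE; apply: wp_seq; apply: wp_mult => //.
move=> m' t' fr; rd; rewrite m4 => v0E t'E; do 2 wp1.
have {}v0E : m' rF = vertex p x (minn i p.+1) by rewrite v0E /vertex; lia.
(* This bounds the time of the multiplication of the vertex by the row length. *)
have v0_le : vertex p x (minn i p.+1) <= N.
  have : minn i p.+1 * p <= p.+1 * p by rewrite leq_mul2r geq_minr orbT.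
  by rewrite /vertex /N; nia.
have fr2 j : j \notin [:: rF; rK; rG; rH] -> m' j = m j.
  move=> jn; rewrite fr; first by rewrite !(upd_frame jn).
  - by apply: contraNneq jn => ->.
  - by apply: contraNneq jn => ->.
  - by apply: contraNneq jn => ->.
rewrite !fr2 // m6 m2 addn0; apply: wp_mult => //; first by rd; rewrite fr2.
move=> m9 t9 fr9; rd; rewrite v0E fr2 // m5 => rA9 t9E.
have fr10 j : j \notin [:: rA; rF; rK; rG; rH] -> m9 j = m j.
  move=> jn; rewrite fr9; first by rewrite !(upd_frame jn) // fr2 // (frame_sub jn).
  - by apply: contraNneq jn => ->.
  - by apply: contraNneq jn => ->.
  - by apply: contraNneq jn => ->.
apply: mQ.
- by split; rewrite fr10.
- by move=> a a30; rewrite fr10 ?z // !inE; lia.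
- by rewrite rA9 /row mulnC.
- have := geq_minr i p.+1; lia.
Qed.

(** The intended content of the table as a function of the address, with 0 in the column of
    marks. *)
Definition cell a : bool :=
  let u := (a - 30) %/ p.+2 in let j := (a - 30) %% p.+2 in
  (j <= p) && edge A u j.

Lemma cell_row u j : j < p.+2 ->
  cell (row u + j) = (j <= p) && edge A u j.
Proof.
move=> jL; rewrite /cell /row -addnA addKn divnMDl // modnMDl.
by rewrite !(divn_small, modn_small) // addn0.
Qed.

(** Everything from address a on is still 0, so the partial table and the free memory behind it are
    described at once. *)
Definition filled (m : nat -> nat) a :=
  forall b, 30 <= b -> m b = (b < a) && cell b.

Lemma filled_step m m' a v (rs : seq nat) :
  filled m a -> 30 <= a -> all (gtn 30) rs ->
  (forall j, j \notin rs -> m' j = upd m a v j) -> v = cell a :> nat ->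
  filled m' a.+1.
Proof.
move=> fil a30 /allP rs30 fr vE b b30.
have bn : b \notin rs by apply/negP => /rs30 /=; rewrite ltnNge b30.
rewrite fr // ltnS leq_eqVlt /upd; case: eqP => [->|_] //=.
by rewrite fil.
Qed.

Lemma filled_frame m m' a (rs : seq nat) :
  filled m a -> all (gtn 30) rs -> (forall j, j \notin rs -> m' j = m j) -> filled m' a.
Proof.
move=> fil /allP rs30 fr b b30; rewrite fr ?fil //.
by apply/negP => /rs30 /=; rewrite ltnNge b30.
Qed.

Definition fill_row_frame := [:: rF; rPtr; rSt; rK; rW].

Lemma wp_fill_row u (Q : (nat -> nat) -> nat -> Prop) m t :
  m rOne = 1 -> filled m (row u) -> m rPtr = row u ->
  m rSt = reached (nseq u L11) -> m rK = p.+1 ->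
  (forall m' t', filled m' (row u + p.+1) -> m' rPtr = row u + p.+1 ->
     (forall j, j < 30 -> j \notin fill_row_frame -> m' j = m j) ->
     t' <= t + 15 * p.+1 -> Q m' t') ->
  wp inp fill_row Q m t.
Proof.
move=> m1 fil ptr st mk mQ.
pose I n (m' : nat -> nat) t' := exists d,
  [/\ [/\ n = p.+1 - d, d <= p & t' + 15 * n <= t + 15 * p.+1],
      filled m' (row u + d), m' rPtr = row u + d,
      m' rSt = reached (nseq u L11 ++ nseq d Ld1) /\ m' rK = n
    & forall j, j < 30 -> j \notin fill_row_frame -> m' j = m j].
apply: (@wp_repeat _ _ _ I _ _ p.+1); last first.
  by exists 0; split=> //; rewrite ?addn0 ?cats0.
move=> {fil ptr st mk} n m2 t2 [d [[nE dp t2E] fil ptr [st mk] fr]].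
have row30 : 30 <= row u + d by rewrite /row -addnA leq_addr.
(* Up to distance p the run is defined, so [rSt] is the code of a state; it becomes 0 only after the
   last pass. *)
have run_d := runs u dp.
apply: wp_seq; apply: wp_read_final => //; first by rewrite fr.
move=> m3 fr3; rewrite st read_accepts // => fin3.
have m31 : m3 rOne = 1 by rewrite fr3 // fr.
do 2 wp1; rewrite fr3 // ptr fin3; do 2 wp1; rewrite fr3 // ptr m31 addn1 -addnS.
apply: wp_seq; apply: wp_read_pad_one => //.
rd; rewrite fr3 // st (read_reached (a := Ld1)) // rcons_cat -nseq_rcons.
move=> m4 fr4 st4; wp1; rewrite !fr4 //; rd; rewrite m31 fr3 // mk subn1.
set m5 := upd m4 _ _.
have fr5 j : j < 30 -> j \notin fill_row_frame -> m5 j = m j.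
  move=> j30 jn; rewrite /m5 (upd_frame jn) // fr4 ?(frame_sub jn) // (upd_frame jn) //.
  rewrite upd_ne; last by apply: contraTneq j30 => ->; rewrite -leqNgt.
  by rewrite fr3 ?(frame_sub jn) // fr.
have fil5 : filled m5 (row u + d.+1).
  rewrite addnS; apply: (@filled_step m2 _ _ (edge A u d) fill_row_frame) => //.
    move=> j jn; rewrite /m5 (upd_frame jn) // fr4 ?(frame_sub jn) // (upd_frame jn) //.
    by rewrite /upd; case: eqP => // _; rewrite fr3 ?(frame_sub jn).
  by rewrite cell_row ?dp // ltnW.
have ptr5 : m5 rPtr = row u + d.+1 by rewrite /m5; rd; rewrite fr4 //; rd.
have st5 : m5 rSt = reached (nseq u L11 ++ nseq d.+1 Ld1) by rewrite /m5; rd.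
have k5 : m5 rK = n.-1 by rewrite /m5; rd.
clearbody m5; case: ifP => [/eqP n0|/negbT n0].
  have dE : d.+1 = p.+1 by clear -nE n0 dp; lia.
  rewrite dE in fil5 ptr5; apply: (mQ m5 _ fil5 ptr5 fr5).
  by clear -t2E nE n0 dp; lia.
exists n.-1; split; first by clear -n0; lia.
exists d.+1; split=> //; clear -t2E nE n0 dp; split; lia.
Qed.

Lemma initialized_frame m m' : initialized m ->
  (forall j, j <= 8 -> m' j = m j) -> initialized m'.
Proof. by case=> [? ? ? ? ? ? ? ? ?] fr; split; rewrite fr. Qed.

Lemma wp_fill (Q : (nat -> nat) -> nat -> Prop) m t :
  initialized m -> (forall a, 30 <= a -> m a = 0) ->
  (forall m' t', initialized m' -> m' rA = m rA -> m' rPtr = row N ->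
     filled m' (row N) -> t' <= t + 3 + N * (15 * p + 24) -> Q m' t') ->
  wp inp fill Q m t.
Proof.
move=> par z mQ; rewrite /fill; do 6 wp1; case: (par) => m0 m1 m2 m3 m4 m5 m6 m7 m8.
rewrite m6 m8 m7 m2 !addn0.
have N_gt0 : 0 < N by rewrite muln_gt0 p_gt0.
pose I n (m' : nat -> nat) t' := exists v,
  [/\ [/\ n = N - v, v < N & t' + n * (15 * p + 24) <= t + 3 + N * (15 * p + 24)],
      filled m' (row v) /\ m' rCnt = n, m' rPtr = row v,
      m' rQ = reached (nseq v L11)
    & forall j, j <= 12 -> m' j = m j].
apply: (@wp_repeat _ _ _ I _ _ N); last first.
  exists 0; split=> //; first by rewrite subn0 addn3.
    split; last by rd.
    by move=> a a30; rd; rewrite z // /row mul0n addn0 ltnNge a30.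
  by move=> j j12; rd.
move=> n m9 t9 [v [[nE vN t9E] [fil cnt] ptr q fr]].
have run_v : run (init A) (nseq v L11) != None.
  by have := runs v (leq0n p); rewrite cats0.
do 4 wp1; rewrite (fr 2) // (fr 3) // m2 m3 q !addn0.
apply: wp_seq; apply: (@wp_fill_row v) => //; try by rd.
- by rd; rewrite fr.
- apply: (@filled_frame m9 _ _ [:: rK; rSt]) => // j jn.
  by rewrite !(upd_frame jn).
move=> m10 t10 fil10 ptr10 fr10 t10E.
do 2 wp1; rewrite ptr10 fr10 //; rd; rewrite fr // m1.
apply: wp_seq; apply: wp_read_one_one => //; rd.
rewrite fr10 //; rd; rewrite q (read_reached (a := L11)) // -nseq_rcons.
move=> m11 fr11 q11; wp1; rewrite !fr11 //; rd; rewrite !fr10 //; rd.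
rewrite cnt fr // m1 subn1.
set m12 := upd m11 _ _.
have row_next : (row v + p.+1).+1 = row v.+1 by rewrite /row mulSn; lia.
have fil12 : filled m12 (row v.+1).
  rewrite -row_next; move=> b b30; rewrite /m12.
  have bn : b \notin [:: rCnt; rW; rQ; rPtr] by rewrite !inE; clear -b30; lia.
  rewrite (upd_frame bn) // fr11 ?(frame_sub bn) // (upd_frame bn) //.
  (* The skipped mark is already right: the memory and [cell] are both 0 there. *)
  have -> : (b < (row v + p.+1).+1) = (b == row v + p.+1) || (b < row v + p.+1).
    by rewrite ltnS leq_eqVlt.
  rewrite fil10 //.
  by case: eqP => [->|_] //; rewrite ltnn cell_row // ltnn.
have ptr12 : m12 rPtr = row v.+1.
  by rewrite /m12; rd; rewrite fr11 //; rd; rewrite addn1.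
have q12 : m12 rQ = reached (nseq v.+1 L11) by rewrite /m12; rd.
have cnt12 : m12 rCnt = n.-1 by rewrite /m12; rd.
have fr12 j : j <= 12 -> m12 j = m j.
  move=> j12; have jn : j \notin [:: rCnt; rW; rQ; rPtr; rF; rSt; rK].
    by rewrite !inE; clear -j12; lia.
  rewrite /m12 (upd_frame jn) // fr11 ?(frame_sub jn) // (upd_frame jn) //.
  rewrite fr10 ?(frame_sub jn) //; last by clear -j12; lia.
  by rewrite !(upd_frame jn) // fr.
clearbody m12; case: ifP => [/eqP n0|/negbT n0].
  have vE : v.+1 = N by clear -nE n0 vN; lia.
  rewrite vE in fil12 ptr12; apply: mQ => //.
  - by apply: initialized_frame par _ => j j8; apply: fr12; apply: leq_trans j8 _.
  - exact: fr12.
  - have n1 : n = 1 by clear -nE n0 vN; lia.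
    by clear -t9E t10E n1; rewrite n1 in t9E; lia.
exists n.-1; split; first by clear -n0; lia.
exists v.+1; split=> //; split; [clear -nE; lia|clear -nE n0; lia|].
have nS : n = n.-1.+1 by clear -n0; lia.
by move: t9E; rewrite {1}nS mulSn; clear -t10E; lia.
Qed.

End Initialization.

(** * The cubic algorithm as a whole *)

Lemma wp_infinity_test A p E x i : presents A p E -> x < p ->
  wp ([:: x; i] ++ encode_dfa A) infinity_test
    (fun m t => t <= 450 * p ^ 3 /\
       exists b : bool, m 0 = b /\ (b <-> infinite_set (component E (vertex p x i))))
    (fun=> 0) 0.
Proof.
move=> presE x_lt; have p_gt0 : 0 < p by apply: leq_ltn_trans x_lt.
have [stdA recA symE _] := presE.
have [runs runs_end _] := standard_runs p_gt0 stdA.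
have runs_end0 := runs_end 0.
set N := p.*2.+1 * p; pose v0 := vertex p x (minn i p.+1).
(* Cutting the index at p + 1 gives a start to which [infinite_componentP] applies and which lies
   inside the table. *)
have v0_lt : v0 < p.+2 * p.
  rewrite /v0 /vertex mulSn addnC -ltn_subRL.
  have : minn i p.+1 * p <= p.+1 * p by rewrite leq_mul2r geq_minr orbT.
  by clear -x_lt; lia.
have v0_N : v0 < N.
  by apply: leq_trans v0_lt _; rewrite leq_mul2r; clear -p_gt0; lia.
have short v u := presents_short (v := v) (u := u) p_gt0 presE.
have shift v u := presents_shift (v := v) (u := u) p_gt0 presE.
have infE : infinite_set (component E (vertex p x i)) <->
    exists u, component E v0 u /\ N <= u.
  rewrite (infinite_component_minn p_gt0 symE short shift).
  exact: (infinite_componentP p_gt0 symE short shift).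
rewrite /infinity_test; apply: wp_seq; apply: (wp_get_sizes (p := p)) => //.
move=> m1 t1 par1 z1 t1E; apply: wp_seq; apply: (wp_get_start p_gt0 x_lt par1 z1) => //.
move=> m2 t2 par2 z2 rA2 t2E; cbv beta in rA2.
apply: wp_seq; apply: (wp_fill _ _ p_gt0 runs par2 z2) => //.
move=> m3 t3 par3 rA3 ptr3 fil3 t3E; cbv beta in ptr3, fil3.
have [ans3 one3 zero3 pp3 p3 len3 base3 rows3 init3] := par3.
do 6 wp1; rewrite ptr3 zero3 !addn0; set m4 := upd _ _ _.
(* The freshly filled table has no marks and represents the empty queue; the visit that follows
   queues the start. *)
have hp4 : heap p N (edge A) m4 [::].
  have cellE v j : v < N -> j < p.+2 -> m4 (30 + v * p.+2 + j) = (j <= p) && edge A v j.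
    move=> vN jL; have lt_row : 30 + v * p.+2 + j < 30 + N * p.+2.
      by apply: (row_queue (p := p) vN jL).
    have a30 : 30 <= 30 + v * p.+2 + j by rewrite -addnA leq_addr.
    rewrite /m4 !upd_ne; try (by apply: contraTneq a30 => ->).
    by rewrite fil3 // lt_row cell_row.
  split; rewrite /m4; rd => //; rewrite ?addn0 //.
  - by move=> v d vN dp; rewrite -/m4 cellE ?dp // ltnW.
  - by move=> v vN; rewrite -/m4 cellE // ltnn.
have ans4 : m4 rAns = 0 by rewrite /m4; rd.
have rA4 : m4 rA = 30 + v0 * p.+2 by rewrite /m4; rd; rewrite rA3 rA2.
have hd4 : m4 rHead = 30 + N * p.+2 by rewrite /m4; rd.
clearbody m4; apply: wp_seq; apply: (wp_visit _ _ hp4 v0_N rA4) => //.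
move=> m5 t5 hp5 fr5 t5E.
have joinedP v u : E v u <-> joined (edge A) v u by exact: joined_edgeP.
have e_le v d : edge A v d -> d <= p by exact: edge_le.
apply: (wp_search _ joinedP e_le v0_N hp5); rewrite ?fr5 //.
move=> m6 t6 b ans6 bE t6E; split; last first.
  by exists b; split=> //; apply: iff_trans bE (iff_sym infE).
(* With these four bounds every term of the running time is at most a multiple of [p ^ 3], constants
   being absorbed since p is positive. *)
have N_le : N <= 3 * p ^ 2.
  by rewrite /N !expnS expn0 muln1 mulnA leq_mul2r; clear -p_gt0; lia.
have p1 : p <= p ^ 3 by rewrite -{1}[p]expn1 leq_pexp2l.
have p2 : p ^ 2 <= p ^ 3 by rewrite leq_pexp2l.
have Np : N * p <= 3 * p ^ 3 by rewrite (expnSr p 2) mulnA leq_mul2r N_le orbT.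
rewrite -/N in t2E t3E; clearbody N.
by clear -p_gt0 t1E t2E t3E t5E t6E N_le p1 p2 Np; lia.
Qed.

(** * The test for a fixed automaton *)

(* Register 9 is 0 exactly if registers 3 and 4 contain the pair [ab]. *)
Definition lookup_case (ab : nat * nat) : cmd :=
  IConst 7 ab.1 ;; IConst 8 ab.2 ;;
  ISub 9 7 3 ;; ISub 10 3 7 ;; IAdd 9 9 10 ;;
  ISub 10 8 4 ;; IAdd 9 9 10 ;; ISub 10 4 8 ;; IAdd 9 9 10 ;;
  Unless 9 (IConst 0 1).

(** There is no empty command; the final instruction is harmless, as register 1 already contains 1
    in [table_test]. *)
Definition lookup (l : seq (nat * nat)) : cmd :=
  foldr (fun ab c => lookup_case ab ;; c) (IConst 1 1) l.

(** Register 2 still holds 0 and register 1 holds 1, so the two readings give x and i, the latter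
    then cut to min(i, n). *)
Definition table_test (n : nat) (l : seq (nat * nat)) : cmd :=
  IConst 1 1 ;; IRead 3 2 ;; IRead 4 1 ;; IConst 5 n ;; ISub 6 4 5 ;; ISub 4 4 6 ;;
  lookup l.

Lemma wp_lookup inp (l : seq (nat * nat)) (x j : nat) (c : bool)
    (Q : (nat -> nat) -> nat -> Prop) (m : nat -> nat) t :
  m 0 = c -> m 3 = x -> m 4 = j ->
  (forall (m' : nat -> nat) t',
     m' 0 = c || ((x, j) \in l) -> t' <= t + 11 * size l + 1 -> Q m' t') ->
  wp inp (lookup l) Q m t.
Proof.
elim: l c m t => [|[a b] l IHl] c m t m0 m3 m4 mQ /=.
  by wp1; apply: mQ; [rd; rewrite in_nil orbF|lia].
apply: wp_seq; rewrite /lookup_case; do 18 wp1; rewrite m3 m4.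
(* Opposite truncated differences add up to an absolute difference, so the sum vanishes only if both
   coordinates agree. *)
have keyE : (a - x + (x - a) + (b - j) + (j - b) == 0) = ((x, j) == (a, b)).
  by rewrite xpair_eqE; apply/eqP/andP => [|[/eqP-> /eqP->]]; [split; apply/eqP|]; lia.
apply: wp_unless; rd; [move=> /eqP|rewrite lt0n]; rewrite keyE => key.
  wp1; apply: (IHl true); rd => // m' t' ans' t'E; apply: mQ; last by move: t'E => /=; lia.
  by rewrite ans' inE key orbT.
apply: (IHl c); rd => // m' t' ans' t'E; apply: mQ; last by move: t'E => /=; lia.
by rewrite ans' inE (negPf key).
Qed.

Lemma wp_table_test n (l : seq (nat * nat)) (x i : nat) :
  wp [:: x; i] (table_test n l)
    (fun m t => t <= 11 * size l + 7 /\ m 0 = ((x, minn i n) \in l)) (fun=> 0) 0.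
Proof.
rewrite /table_test; do 12 wp1.
apply: (@wp_lookup _ _ x (minn i n) false); rd => //; first by rewrite /= minnE.
by move=> m t ans tE; split=> //; lia.
Qed.

Theorem theorem6p1 :
  (exists (P : program) (C : nat),
     forall (A : dfa) (p : nat) (E : relation nat), presents A p E ->
     forall x i : nat, x < p ->
       decides_within P ([:: x; i] ++ encode_dfa A) (C * p ^ 3)
         (infinite_set (component E (vertex p x i)))) /\
  (forall (A : dfa) (p : nat) (E : relation nat), presents A p E ->
     exists (P : program) (T : nat), forall x i : nat, x < p ->
       decides_within P [:: x; i] T
         (infinite_set (component E (vertex p x i)))).
Proof.
split.
  exists (code 0 infinity_test), 450 => A p E presE x i x_lt.
  exact/decides_wp/wp_infinity_test.
move=> A p E presE.
(* The list of positive answers is obtained by classical logic: the program may depend on the graph,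
   so the existence of the list suffices. *)
pose l := [seq ab <- [seq (a, b) | a <- iota 0 p, b <- iota 0 p.+2]
          | `[< infinite_set (component E (vertex p ab.1 ab.2)) >]].
exists (code 0 (table_test p.+1 l)), (11 * size l + 7) => x i x_lt.
apply/decides_wp/(wp_mono (wp_table_test p.+1 l x i)) => m t [tE ans].
split=> //; exists ((x, minn i p.+1) \in l); split=> //.
have p_gt0 : 0 < p by apply: leq_ltn_trans x_lt.
have [_ _ symE _] := presE.
have short v u := presents_short (v := v) (u := u) p_gt0 presE.
have shift v u := presents_shift (v := v) (u := u) p_gt0 presE.
(* The pair with cut index is among those tabulated, so its membership in [l] is exactly the
   answer. *)
rewrite (infinite_component_minn p_gt0 symE short shift) mem_filter allpairs_f; last first.
- by rewrite mem_iota add0n ltnS geq_minr.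
- by rewrite mem_iota.
by rewrite andbT; split=> /asboolP.
Qed.
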